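(* For all $x\in\mathbb{R}$ and $4\times10^{-13}<q<1$, the following approximate formulas hold as $q\to1^-$: (i) $$\sin(\pi x)=q^{\frac12\left(x-\frac12\right)^2}\frac{\Gamma_q^2\left(\frac12\right)}{\Gamma_q(x)\Gamma_q(1-x)}+O\!\left(e^{\frac{\pi^2}{\log q}}\right)=q^{\frac12\left(x-\frac12\right)^2}\prod_{k=0}^\infty\frac{(1-q^{k+x})(1-q^{k+1-x})}{\left(1-q^{k+\frac12}\right)^2}+O\!\left(e^{\frac{\pi^2}{\log q}}\right);$$ (ii) $$\sin(\pi x)=\pi q^{\frac{x(x-1)}{2}}\frac{1-q}{\log(q^{-1})\,\Gamma_q(x)\Gamma_q(1-x)}+O\!\left(e^{\frac{\pi^2}{\log q}}\right)=\pi q^{\frac{x(x-1)}{2}}\frac{1}{\log(q^{-1})}\prod_{k=0}^\infty\frac{(1-q^{k+x})(1-q^{k+1-x})}{(1-q^{k+1})^2}+O\!\left(e^{\frac{\pi^2}{\log q}}\right).$$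
   Context: For $0<q<1$ and real $x\notin\{0,-1,-2,\dots\}$, $\Gamma_q(x)=\frac{(q;q)_\infty}{(q^x;q)_\infty}(1-q)^{1-x}$ with $(a;q)_\infty=\prod_{k=0}^\infty(1-aq^k)$; at the poles $x=0,-1,-2,\dots$ the reciprocal $1/\Gamma_q(x)$ is understood to be $0$. *)

(* Defs.v *)
From mathcomp Require Import all_boot all_order all_algebra.
From mathcomp Require Import all_classical all_reals all_analysis.

Set Implicit Arguments.
Unset Strict Implicit.
Unset Printing Implicit Defensive.

Import Order.TTheory GRing.Theory Num.Theory.
Import numFieldNormedType.Exports.

Local Open Scope classical_set_scope.
Local Open Scope ring_scope.

Definition infprod (R : realType) (u : nat -> R) : R :=
  limn (fun n => \prod_(0 <= k < n) u k).

Definition qpoch (R : realType) (a q : R) : R :=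
  infprod (fun k => 1 - a * q ^+ k).

(* At the poles x = 0, -1, -2, ... the factor qpoch (q `^ x) q is 0, so that,
   since 0^-1 = 0, this formula returns 0 there; hence (Gamma_q q x)^-1 = 0
   at the poles, the usual convention for the reciprocal of Gamma_q. *)
Definition Gamma_q (R : realType) (q x : R) : R :=
  qpoch q q / qpoch (q `^ x) q * (1 - q) `^ (1 - x).

(* f x q = g x q + O(exp(pi^2 / log q)) for real x and 4 * 10^-13 < q < 1:
   the implied constant is absolute, i.e. it depends neither on x nor on q.
   The bound covers the whole range of q, and so the limit q -> 1^- . *)
Definition eq_upto_O (R : realType) (f g : R -> R -> R) : Prop :=
  exists C : R, forall x q : R, 4 * 10 ^- 13 < q < 1 ->
    `|f x q - g x q| <= C * expR (pi ^+ 2 / ln q).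

(* Main.v *)
Require Import Defs.
From mathcomp Require Import all_boot all_order all_algebra.
From mathcomp Require Import all_classical all_reals all_analysis.
From mathcomp Require Import zify ring lra.

(* Write q = e^-t, theta_t(x) = sum_n e^(-t (n + x)^2 / 2) over the integers, and let alpha_t(x)
   be the same sum with signs (-1)^n.  By Jacobi's triple product, the right-hand side of (i) is
   c_t(x - 1/2) with c_t = alpha_t / alpha_t(0), and that of (ii) is a constant multiple of it.

   No modular transformation is needed.  Rearranging a product of two theta sums along
   (m, n) |-> (m + n, m - n) gives, with g_t = theta_t / theta_t(0),
     c_2t(x) = g_t(x) c_t(x)   and
     2 c_2t(x) c_2t(y) = g_t(x + y) c_t(x - y) + c_t(x + y) g_t(x - y),
   and also mu_t <= g_t <= 1 for mu_t = g_t(1/2), where mu_t^2 (1 + mu_2t^2) = 2 mu_2t.  Hence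
   1 - mu_t <= (1 - mu_2t)^2, so the gap 1 - mu_t squares when t is halved; a numerical check on
   4 <= t <= 8 then yields 1 - mu_t <= e^(-pi^2 / 2t) for all t <= 8.  So c_(t / 2^n) converges, and
   its limit satisfies d'Alembert's equation exactly, that is, the limit is cos (pi x).  Therefore
   c_t(x) = L cos (pi x), where L = prod_(j >= 1) g_(t / 2^j)(x) is 1 + O(e^(-pi^2 / t)).
   The error being relative, letting x tend to a zero of the cosine gives the constant in (ii). *)

Import Order.TTheory GRing.Theory Num.Theory.
Import numFieldNormedType.Exports.

Local Open Scope classical_set_scope.
Local Open Scope ring_scope.

(** * Sums over the integers *)

Section IntegerSums.
Context {R : realType}.
Local Open Scope ereal_scope.

Lemma esum_int (a : int -> \bar R) : (forall n, 0 <= a n) ->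
  \esum_(n in [set: int]) a n = \sum_(k <oo) (a (Posz k) + a (Negz k)).
Proof.
move=> a0; rewrite (esumID (range Posz))// setTI.
have -> : [set: int] `&` ~` range Posz = range Negz.
  apply/seteqP; split => [[k|k]|n] /=.
  - by case=> _; case; exists k.
  - by move=> _; exists k.
  - by case=> k _ <-; split => // -[].
rewrite !esum_image; do ?by move=> i j _ _ [].
by rewrite -!nneseries_esumT// nneseriesD.
Qed.

Lemma esum_intZl (c : R) (a : int -> \bar R) : (0 <= c)%R -> (forall n, 0 <= a n) ->
  \esum_(n in [set: int]) (c%:E * a n) = c%:E * \esum_(n in [set: int]) a n.
Proof.
move=> c0 a0; rewrite !esum_int//; last by move=> n; rewrite mule_ge0 ?lee_fin.
rewrite -nneseriesZl//; last by move=> k _; rewrite adde_ge0.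
by apply: eq_eseriesr => k _; rewrite ge0_muleDr.
Qed.

Lemma esum_bool {T : choiceType} (a : bool -> T -> \bar R) : (forall b k, 0 <= a b k) ->
  \esum_(k in [set: bool * T]) a k.1 k.2 =
  \esum_(k in [set: T]) a false k + \esum_(k in [set: T]) a true k.
Proof.
move=> a0.
have -> : [set: bool * T] = [set: bool] `*`` (fun=> [set: T]).
  by apply/seteqP; split => -[].
rewrite -(@esum_esum _ _ _ [set: bool] (fun=> [set: T]) (fun b k => a b k))//.
rewrite (esumID [set false]); last by move=> i _; exact: esum_ge0.
rewrite !setTI esum_set1; last exact: esum_ge0.
have -> : ~` [set false] = [set true] by apply/seteqP; split => -[] //= [].
by rewrite esum_set1//; exact: esum_ge0.
Qed.

Lemma esum_int_parity (a : int -> \bar R) : (forall n, 0 <= a n) ->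
  \esum_(n in [set: int]) a n =
  \esum_(m in [set: int]) a (2 * m)%R + \esum_(m in [set: int]) a (2 * m + 1)%R.
Proof.
move=> a0; rewrite (@reindex_esum _ _ _ [set: bool * int] _
  (fun k => (2 * k.2 + (k.1 : nat)%:Z)%R)).
  rewrite (esum_bool (fun b m => a (2 * m + (b : nat)%:Z)%R))//.
  by congr (_ + _); apply: eq_esum => m _; rewrite ?addr0.
split=> // [[b1 m1] [b2 m2] _ _ /= h|n _].
  by have [-> ->] : b1 = b2 /\ m1 = m2 by case: b1 b2 h => -[] /= h; split; lia.
exists ((n %% 2)%Z == 1%R, (n %/ 2)%Z) => //=.
have : ((n %% 2)%Z = 0 \/ (n %% 2)%Z = 1)%R by lia.
by case=> h; rewrite h /=; lia.
Qed.

Lemma esum_int_pair (a b : int -> \bar R) :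
  (forall n, 0 <= a n) -> (forall n, 0 <= b n) -> (forall n, a n \is a fin_num) ->
  (\esum_(n in [set: int]) a n) \is a fin_num ->
  (\esum_(n in [set: int]) b n) \is a fin_num ->
  (\esum_(m in [set: int]) a m) * (\esum_(n in [set: int]) b n) =
  \esum_(k in [set: int * int]) (a k.1 * b k.2).
Proof.
move=> a0 b0 afin sa sb.
have -> : [set: int * int] = [set: int] `*`` (fun=> [set: int]).
  by apply/seteqP; split => -[].
rewrite -(@esum_esum _ _ _ [set: int] (fun=> [set: int]) (fun m n => a m * b n)); last first.
  by move=> *; rewrite mule_ge0.
rewrite -[in LHS](fineK sb) muleC -esum_intZl//; last exact/fine_ge0/esum_ge0.
apply: eq_esum => m _; rewrite (fineK sb) muleC -(fineK (afin m)) esum_intZl//.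
exact: fine_ge0.
Qed.

(** The pairs [(m + n, m - n)] are exactly those whose entries have equal parity, and raising the
    first entry by one reaches all the others. This is the rearrangement behind [thetaM]. *)
Lemma esum_int2_parity (a : int * int -> \bar R) : (forall n, 0 <= a n) ->
  \esum_(k in [set: int * int]) a k =
  \esum_(k in [set: int * int]) a (k.1 + k.2, k.1 - k.2)%R +
  \esum_(k in [set: int * int]) a (k.1 + k.2 + 1, k.1 - k.2)%R.
Proof.
move=> a0; rewrite (@reindex_esum _ _ _ [set: bool * (int * int)] _
  (fun k => (k.2.1 + k.2.2 + (k.1 : nat)%:Z, k.2.1 - k.2.2)%R)).
  rewrite (esum_bool (fun b k => a (k.1 + k.2 + (b : nat)%:Z, k.1 - k.2)%R))//.
  by congr (_ + _); apply: eq_esum => m _; rewrite ?addr0.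
split=> // [[b1 [m1 n1]] [b2 [m2 n2]] _ _ /= [h1 h2]|[m n] _].
  have [-> [-> ->]] // : b1 = b2 /\ m1 = m2 /\ n1 = n2.
  by case: b1 b2 h1 => -[] /= h1; do ?split; lia.
exists (((m + n) %% 2)%Z == 1%R, (((m + n) %/ 2)%Z, ((m + n) %/ 2)%Z - n)%R) => //=.
have : (((m + n) %% 2)%Z = 0 \/ ((m + n) %% 2)%Z = 1)%R by lia.
by case=> h; rewrite h /=; congr (_, _); lia.
Qed.

End IntegerSums.

(** * Theta sums *)

Section Theta.
Context {R : realType}.
Implicit Types t x y : R.

Definition gauss t x : R := expR (- (t / 2 * x ^+ 2)).

(** Nonnegative sums in the extended reals can be reindexed before they are known to be finite;
    [theta] then takes the real value. *)
Definition etheta t x : \bar R :=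
  \esum_(n in [set: int]) (gauss t (n%:~R + x))%:E.

Definition theta t x : R := fine (etheta t x).

Lemma gauss_gt0 t x : 0 < gauss t x. Proof. exact: expR_gt0. Qed.
Lemma gauss_ge0 t x : 0 <= gauss t x. Proof. exact: expR_ge0. Qed.
Hint Resolve gauss_gt0 gauss_ge0 : core.

Lemma gaussN t x : gauss t (- x) = gauss t x.
Proof. by rewrite /gauss sqrrN. Qed.

Lemma gauss_le t x y : 0 <= t -> 0 <= x <= y -> gauss t y <= gauss t x.
Proof.
move=> t0 /andP[x0 xy]; rewrite ler_expR lerN2 ler_wpM2l ?divr_ge0//.
by rewrite lerXn2r ?nnegrE// (le_trans x0).
Qed.

Lemma etheta_ge0 t x : (0 <= etheta t x)%E.
Proof. by apply: esum_ge0 => n _; rewrite lee_fin. Qed.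

Lemma etheta_intD t x (m : int) : etheta t (x + m%:~R) = etheta t x.
Proof.
rewrite {2}/etheta (@reindex_esum _ _ _ [set: int] _ (fun n => n + m)).
  by apply: eq_esum => n _; rewrite intrD -addrA (addrC m%:~R).
split => // [i j _ _ /addIr//|n _]; exists (n - m) => //; exact: subrK.
Qed.

Lemma ethetaN t x : etheta t (- x) = etheta t x.
Proof.
rewrite {2}/etheta (@reindex_esum _ _ _ [set: int] _ (fun n => - n)).
  by apply: eq_esum => n _; rewrite intrN -(gaussN t (- _ + x)) opprD opprK.
split => // [i j _ _ /oppr_inj//|n _]; exists (- n) => //; exact: opprK.
Qed.

Lemma etheta_nat t x : etheta t x =
  (\sum_(k <oo) (gauss t (k%:R + x) + gauss t (k.+1%:R - x))%:E)%E.
Proof.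
rewrite /etheta esum_int; last by move=> n; rewrite lee_fin.
apply: eq_eseriesr => k _; rewrite EFinD; congr (_ + _)%E.
by rewrite -gaussN NegzE intrN opprD opprK.
Qed.

Lemma gauss_nat_le t (k : nat) : 0 <= t -> gauss t k%:R <= expR (- (t / 2)) ^+ k.
Proof.
move=> t0; rewrite -expRM_natl ler_expR mulrN lerN2 [leLHS]mulrC ler_wpM2l ?divr_ge0//.
by rewrite -natrX ler_nat; case: k => // k; rewrite expnS leq_pmulr.
Qed.

Lemma geometric_sum_le (z : R) n : 0 <= z < 1 -> \sum_(0 <= k < n) z ^+ k <= (1 - z)^-1.
Proof.
move=> /andP[z0 z1]; have z1' : 0 < 1 - z by rewrite subr_gt0.
rewrite -[leRHS]mul1r ler_pdivlMr// mulrC.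
have -> : (1 - z) * \sum_(0 <= k < n) z ^+ k = 1 - z ^+ n.
  elim: n => [|n IH]; first by rewrite big_nil mulr0 subrr.
  by rewrite big_nat_recr//= mulrDr IH exprS; ring.
by rewrite lerBlDr lerDl exprn_ge0.
Qed.

Lemma expR_lt1_nng t : 0 < t -> 0 <= expR (- (t / 2)) < 1.
Proof. by move=> t0; rewrite expR_ge0 expR_lt1 oppr_lt0 divr_gt0. Qed.

(** For [0 <= x <= 1] both terms paired at index [k] have an argument of at least [k], so each is
    below a geometric term, because [k <= k ^ 2]. *)
Lemma etheta01_le t x : 0 < t -> 0 <= x <= 1 ->
  (etheta t x <= (2 / (1 - expR (- (t / 2))))%:E)%E.
Proof.
move=> t0 /andP[x0 x1]; rewrite etheta_nat.
apply: lime_le.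
  by apply: is_cvg_nneseries => k _ _; rewrite lee_fin addr_ge0.
apply: nearW => n; rewrite sumEFin lee_fin.
apply: (@le_trans _ _ (\sum_(0 <= k < n) 2 * expR (- (t / 2)) ^+ k)).
  apply: ler_sum => k _; rewrite (_ : 2 = 1 + 1)// mulrDl mul1r.
  rewrite lerD// (le_trans _ (gauss_nat_le _ k (ltW t0)))// gauss_le ?(ltW t0)//.
    by rewrite ler0n lerDl.
  by rewrite ler0n -natr1 -addrA lerDl subr_ge0.
by rewrite -mulr_sumr ler_wpM2l// geometric_sum_le// expR_lt1_nng.
Qed.

Lemma subr_floor_itv x : 0 <= x + (- Num.floor x)%:~R < 1.
Proof.
have /andP[] := floor_itv x; rewrite intrD intrN => h1 h2.
by apply/andP; split; lra.
Qed.

Lemma etheta_le t x : 0 < t -> (etheta t x <= (2 / (1 - expR (- (t / 2))))%:E)%E.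
Proof.
move=> t0; rewrite -(etheta_intD _ _ (- Num.floor x)) etheta01_le//.
by case/andP: (subr_floor_itv x) => -> /ltW ->.
Qed.

Lemma etheta_fin_num t x : 0 < t -> etheta t x \is a fin_num.
Proof.
move=> t0; rewrite ge0_fin_numE ?etheta_ge0//.
exact: le_lt_trans (etheta_le _ _ t0) (ltry _).
Qed.

Lemma theta_intD t x (m : int) : theta t (x + m%:~R) = theta t x.
Proof. by rewrite /theta etheta_intD. Qed.

Lemma thetaD1 t x : theta t (x + 1) = theta t x.
Proof. exact: (theta_intD _ _ 1). Qed.

Lemma thetaN t x : theta t (- x) = theta t x.
Proof. by rewrite /theta ethetaN. Qed.

Lemma theta_series t x : 0 < t ->
  (fun n => \sum_(0 <= k < n) (gauss t (k%:R + x) + gauss t (k.+1%:R - x))) @ \oo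
    --> theta t x.
Proof.
move=> t0; rewrite (_ : (fun n => _) = fine \o (fun n =>
   \sum_(0 <= k < n) (gauss t (k%:R + x) + gauss t (k.+1%:R - x))%:E)%E); last first.
  by apply/funext => n /=; rewrite sumEFin.
apply: fine_cvg; rewrite /theta fineK ?etheta_fin_num// etheta_nat.
by apply: is_cvg_nneseries => k _ _; rewrite lee_fin addr_ge0.
Qed.

Lemma theta_partial_le t x n : 0 < t ->
  \sum_(0 <= k < n) (gauss t (k%:R + x) + gauss t (k.+1%:R - x)) <= theta t x.
Proof.
move=> t0; have h := theta_series t x t0.
rewrite -(cvg_lim (@Rhausdorff R) h).
apply: nondecreasing_cvgn_le; last by apply/cvg_ex; eexists; exact: h.
by apply/nondecreasing_seqP => m; rewrite big_nat_recr//= lerDl addr_ge0.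
Qed.

Lemma theta_le t x M : 0 < t ->
  (forall n, \sum_(0 <= k < n) (gauss t (k%:R + x) + gauss t (k.+1%:R - x)) <= M) ->
  theta t x <= M.
Proof.
move=> t0 hM; have h := theta_series t x t0.
rewrite -(cvg_lim (@Rhausdorff R) h); apply: limr_le.
  by apply/cvg_ex; eexists; exact: h.
exact: nearW.
Qed.

Lemma gauss2_le_theta t x : 0 < t -> gauss t x + gauss t (1 - x) <= theta t x.
Proof. by move=> /(theta_partial_le _ x 1); rewrite big_nat1 add0r. Qed.

Lemma theta_gt0 t x : 0 < t -> 0 < theta t x.
Proof. by move=> /(gauss2_le_theta _ x); apply: lt_le_trans; rewrite addr_gt0. Qed.

Lemma theta_le_bound t x : 0 < t -> theta t x <= 2 / (1 - expR (- (t / 2))).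
Proof. by move=> t0; rewrite -lee_fin fineK ?etheta_fin_num ?etheta_le. Qed.

(** By periodicity [x] may be taken in [[0, 1)], where the term [gauss t x] alone suffices. The
    uniformity in [x] provides the bounded quotient in [theta_min_le]. *)
Lemma theta_ge_bound t x : 0 < t -> gauss t 1 <= theta t x.
Proof.
move=> t0; rewrite -(theta_intD _ _ (- Num.floor x)).
have /andP[h0 /ltW h1] := subr_floor_itv x.
apply: le_trans (gauss2_le_theta _ _ t0); apply: le_trans (_ : gauss t 1 + 0 <= _).
  by rewrite addr0.
by rewrite lerD// gauss_le ?(ltW t0)// h0.
Qed.

Lemma theta_split t x : 0 < t ->
  theta t x = theta (4 * t) (x / 2) + theta (4 * t) ((x + 1) / 2).
Proof.
move=> t0; have t40 : 0 < 4 * t by rewrite mulr_gt0.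
apply: EFin_inj; rewrite EFinD !fineK ?etheta_fin_num//.
rewrite {1}/etheta esum_int_parity; last by move=> n; rewrite lee_fin.
congr (_ + _)%E; apply: eq_esum => n _; rewrite /gauss; congr ((expR _)%:E).
  by rewrite intrM; field.
by rewrite intrD intrM; field.
Qed.

(** For indices of equal parity, [(m + n + x)^2 + (m - n + y)^2 = 2 (m + (x + y) / 2)^2 + 2 (n + (x
    - y) / 2)^2], so the rearranged double sum factors; opposite parity gives the half-shifted
    product. *)
Lemma thetaM t x y : 0 < t ->
  theta t x * theta t y =
  theta (2 * t) ((x + y) / 2) * theta (2 * t) ((x - y) / 2) +
  theta (2 * t) ((x + y + 1) / 2) * theta (2 * t) ((x - y + 1) / 2).
Proof.
move=> t0; have t20 : 0 < 2 * t by rewrite mulr_gt0.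
apply: EFin_inj; rewrite EFinD !EFinM !fineK ?etheta_fin_num//.
rewrite !esum_int_pair ?etheta_fin_num//; do ?by move=> n; rewrite lee_fin.
rewrite esum_int2_parity; last by move=> n; rewrite mule_ge0 ?lee_fin.
congr (_ + _)%E; apply: eq_esum => -[m n] _ /=; rewrite -!EFinM; congr (_%:E);
  rewrite /gauss -!expRD; congr (expR _); rewrite ?(intrD, intrN); by field.
Qed.

End Theta.

(** * The alternating theta sum: product formulas and alternating-series bounds *)

Section AltTheta.
Context {R : realType}.
Implicit Types s t u v x y : R.

Lemma theta_mulDB t u v : 0 < t ->
  theta t (u + v) * theta t (u - v) =
  theta (2 * t) u * theta (2 * t) v +
  theta (2 * t) (u + 2^-1) * theta (2 * t) (v + 2^-1).
Proof.
move=> t0; rewrite thetaM//; congr (theta _ _ * theta _ _ + theta _ _ * theta _ _);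
  by field.
Qed.

Lemma thetaDhalf t x : theta t (x + 2^-1) = theta t (x - 2^-1).
Proof. by rewrite -(thetaD1 t (x - _)); congr theta; field. Qed.

(** This is the sum of [(-1)^n gauss t (n + x)] over all integers [n], with the even and the odd
    terms collected separately so that only nonnegative sums occur. *)
Definition theta_alt t x : R := theta (4 * t) (x / 2) - theta (4 * t) ((x + 1) / 2).

Lemma theta_altN t x : theta_alt t (- x) = theta_alt t x.
Proof.
rewrite /theta_alt mulNr thetaN; congr (_ - _).
by rewrite -thetaN -(thetaD1 _ (- _)); congr theta; field.
Qed.

Lemma theta_altD1 t x : theta_alt t (x + 1) = - theta_alt t x.
Proof.
rewrite /theta_alt opprB; congr (_ - _).
by rewrite -(thetaD1 _ (x / 2)); congr theta; field.
Qed.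

Lemma theta_alt_half t : theta_alt t 2^-1 = 0.
Proof.
have : theta_alt t 2^-1 = - theta_alt t 2^-1.
  by rewrite -[in RHS]theta_altN -theta_altD1; congr theta_alt; field.
lra.
Qed.

Lemma theta4E t x : 0 < t ->
  theta (4 * t) x = (theta t (2 * x) + theta_alt t (2 * x)) / 2.
Proof.
move=> t0; rewrite (theta_split _ (2 * x))// /theta_alt (mulrC 2) mulfK//.
by field.
Qed.

Lemma theta4DhalfE t x : 0 < t ->
  theta (4 * t) (x + 2^-1) = (theta t (2 * x) - theta_alt t (2 * x)) / 2.
Proof.
move=> t0; rewrite (theta_split _ (2 * x))// /theta_alt.
by rewrite (_ : (2 * x + 1) / 2 = x + 2^-1); field.
Qed.

(** Both products on the right expand into products at [4 * t], and their difference consists of the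
    four terms of [(a - b) (c - d)]. *)
Lemma theta_altM t x y : 0 < t ->
  theta_alt t (2 * x) * theta_alt t (2 * y) =
  theta (2 * t) (x + y) * theta (2 * t) (x - y) -
  theta (2 * t) (x + y + 2^-1) * theta (2 * t) (x - y + 2^-1).
Proof.
move=> t0; have t20 : 0 < 2 * t by rewrite mulr_gt0.
have h1 := theta_mulDB (2 * t) x y t20.
have h2 := theta_mulDB (2 * t) x (y + 2^-1) t20.
rewrite (_ : 2 * (2 * t) = 4 * t) in h1 h2; last by ring.
rewrite (_ : y + 2^-1 + 2^-1 = y + 1) ?thetaD1 in h2; last by field.
rewrite (_ : x + (y + 2^-1) = x + y + 2^-1) in h2; last by ring.
rewrite (_ : x - (y + 2^-1) = x - y - 2^-1) -?thetaDhalf in h2; last by ring.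
rewrite h1 h2 /theta_alt.
rewrite (_ : 2 * x / 2 = x); last by field.
rewrite (_ : 2 * y / 2 = y); last by field.
rewrite (_ : (2 * x + 1) / 2 = x + 2^-1); last by field.
rewrite (_ : (2 * y + 1) / 2 = y + 2^-1); last by field.
by ring.
Qed.

Lemma theta_alt_mulDB t u v : 0 < t ->
  theta_alt t (u + v) * theta_alt t (u - v) =
  theta (2 * t) u * theta (2 * t) v -
  theta (2 * t) (u + 2^-1) * theta (2 * t) (v + 2^-1).
Proof.
move=> t0; have := theta_altM t ((u + v) / 2) ((u - v) / 2) t0.
rewrite (_ : 2 * ((u + v) / 2) = u + v); last by field.
rewrite (_ : 2 * ((u - v) / 2) = u - v); last by field.
rewrite (_ : (u + v) / 2 + (u - v) / 2 = u); last by field.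
by rewrite (_ : (u + v) / 2 - (u - v) / 2 = v); last by field.
Qed.

(* An approximate d'Alembert equation, since [theta s] is nearly constant for small [s]. *)
Lemma theta_alt_dalembert s x y : 0 < s ->
  theta_alt (2 * s) x * theta_alt (2 * s) y =
  (theta s (x + y) * theta_alt s (x - y) + theta_alt s (x + y) * theta s (x - y)) / 2.
Proof.
move=> s0; have := theta_alt_mulDB (2 * s) ((x + y) / 2) ((x - y) / 2).
rewrite (_ : (x + y) / 2 + (x - y) / 2 = x); last by field.
rewrite (_ : (x + y) / 2 - (x - y) / 2 = y); last by field.
move=> ->; last by rewrite mulr_gt0.
rewrite (_ : 2 * (2 * s) = 4 * s); last by ring.
rewrite !theta4DhalfE// !theta4E//.
rewrite (_ : 2 * ((x + y) / 2) = x + y); last by field.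
rewrite (_ : 2 * ((x - y) / 2) = x - y); last by field.
by field.
Qed.

Lemma theta_alt_double s x : 0 < s ->
  theta_alt (2 * s) x * theta_alt (2 * s) 0 = theta s x * theta_alt s x.
Proof. by move=> s0; rewrite theta_alt_dalembert// addr0 subr0; field. Qed.

(** At [v = 1/4] the two theta values in [v] coincide, by evenness and periodicity.
    [theta_prod_quarter] is the same recursion for the product side of the triple product. *)
Lemma theta_alt_quarter t x : 0 < t ->
  theta_alt (2 * t) (x / 2 + 4^-1) * theta_alt (2 * t) (x / 2 - 4^-1) =
  theta (4 * t) 4^-1 * theta_alt t x.
Proof.
move=> t0; rewrite theta_alt_mulDB; last by rewrite mulr_gt0.
rewrite (_ : 2 * (2 * t) = 4 * t); last by ring.
rewrite (_ : 4^-1 + 2^-1 = - 4^-1 + 1); last by field.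
rewrite thetaD1 thetaN /theta_alt (_ : (x + 1) / 2 = x / 2 + 2^-1); last by field.
by ring.
Qed.

(** Up to the sign [(-1)^n], this joins the terms of index [n] and [-(n + 1)] of the alternating
    sum. *)
Let gap t x (n : nat) := gauss t (n%:R + x) - gauss t (n.+1%:R - x).

Lemma theta_alt_series t x : 0 < t ->
  (fun n => \sum_(0 <= k < n) (gap t x k.*2 - gap t x k.*2.+1)) @ \oo
  --> theta_alt t x.
Proof.
move=> t0; have t40 : 0 < 4 * t by rewrite mulr_gt0.
rewrite (_ : (fun n => _) =
  (fun n => \sum_(0 <= k < n)
    (gauss (4 * t) (k%:R + x / 2) + gauss (4 * t) (k.+1%:R - x / 2))) \-
  (fun n => \sum_(0 <= k < n)
    (gauss (4 * t) (k%:R + (x + 1) / 2) + gauss (4 * t) (k.+1%:R - (x + 1) / 2)))).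
  by apply: cvgB; exact: theta_series.
apply/funext => n /=; rewrite -sumrB; apply: eq_bigr => k _.
have g4 y : gauss (4 * t) y = gauss t (2 * y).
  by rewrite /gauss; congr (expR _); field.
rewrite !g4 /gap -!mul2n -(@natr1 _ k) -(@natr1 _ (2 * k).+1) -(@natr1 _ (2 * k)) natrM.
rewrite (_ : 2 * (k%:R + x / 2) = 2 * k%:R + x); last by field.
rewrite (_ : 2 * (k%:R + 1 - x / 2) = 2 * k%:R + 1 + 1 - x); last by field.
rewrite (_ : 2 * (k%:R + (x + 1) / 2) = 2 * k%:R + 1 + x); last by field.
rewrite (_ : 2 * (k%:R + 1 - (x + 1) / 2) = 2 * k%:R + 1 - x); last by field.
by ring.
Qed.

Let gapE t x n : gap t x n = gauss t (n%:R + x) * (1 - expR (- (t * (2^-1 - x))) ^+ n.*2.+1).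
Proof.
rewrite mulrBr mulr1 /gap; congr (_ - _).
rewrite -expRM_natl /gauss -expRD; congr (expR _).
by rewrite -(@natr1 _ n) -(@natr1 _ n.*2) -mul2n natrM; field.
Qed.

(** With [z = w ^ (2n + 1)], one has [1 - z w^2 = (1 - z) + z (1 - w) (1 + w)], and the last product
    is at most [2 (1 - w) <= 2 (1 - z)]. *)
Let pow_step (w : R) n : 0 <= w <= 1 ->
  0 <= 1 - w ^+ n.*2.+1 /\ 1 - w ^+ n.+1.*2.+1 <= 3 * (1 - w ^+ n.*2.+1).
Proof.
move=> /andP[w0 w1]; rewrite doubleS.
have z0 : 0 <= w ^+ n.*2 <= 1 by rewrite exprn_ge0//= exprn_ile1.
have h0 : 0 <= w * w ^+ n.*2 by rewrite mulr_ge0//; case/andP: z0.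
have h1 : w * w ^+ n.*2 <= w by rewrite ler_piMr//; case/andP: z0.
rewrite !exprS; set z := w * _ in h0 h1 *.
have h2 : (1 - w) * (z * (1 + w)) <= (1 - w) * 2 by rewrite ler_wpM2l; nra.
by split; nra.
Qed.

Let gap_ge0 t x n : 0 <= t -> 0 <= x <= 2^-1 -> 0 <= gap t x n.
Proof.
move=> t0 /andP[x0 x1]; rewrite gapE mulr_ge0 ?gauss_ge0//.
have hw : 0 <= expR (- (t * (2^-1 - x))) <= 1.
  by rewrite expR_ge0 expR_le1 oppr_le0 mulr_ge0// subr_ge0.
by have [] := pow_step _ n hw.
Qed.

Let gap_step t x n : 0 <= t -> 0 <= x <= 2^-1 ->
  gap t x n.+1 <= 3 * expR (- (t / 2)) * gap t x n.
Proof.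
move=> t0 /andP[x0 x1]; rewrite !gapE.
have [] := pow_step (expR (- (t * (2^-1 - x)))) n.
  by rewrite expR_ge0 expR_le1 oppr_le0 mulr_ge0// subr_ge0.
set z := 1 - _ ^+ n.*2.+1; set z' := 1 - _ => z0 zz'.
rewrite [leRHS](_ : _ = expR (- (t / 2)) * gauss t (n%:R + x) * (3 * z)); last by ring.
apply: (@le_trans _ _ (gauss t (n.+1%:R + x) * (3 * z))).
  by rewrite ler_wpM2l ?gauss_ge0.
rewrite ler_wpM2r ?mulr_ge0// /gauss -expRD ler_expR -(@natr1 _ n).
have : 0 <= n%:R :> R by []. 
nra.
Qed.

(** The gaps shrink at each step by a factor of at most [3 e^(-t/2) <= 1], so the alternating series
    lies between its first term minus its second and its first term. *)
Lemma theta_alt_bounds t x : 0 < t -> 3 * expR (- (t / 2)) <= 1 -> 0 <= x <= 2^-1 ->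
  (1 - 3 * expR (- (t / 2))) * (gauss t x - gauss t (1 - x)) <= theta_alt t x
    <= gauss t x - gauss t (1 - x).
Proof.
move=> t0 ht hx; have h := theta_alt_series t x t0.
have ht0 := ltW t0.
have dec n : gap t x n.+1 <= gap t x n.
  by rewrite (le_trans (gap_step _ _ _ _ _))// ler_piMl// gap_ge0.
have gap0 : gap t x 0%N = gauss t x - gauss t (1 - x) by rewrite /gap add0r.
rewrite -gap0 -(cvg_lim (@Rhausdorff R) h); apply/andP; split.
  apply: limr_ge; first by apply/cvg_ex; eexists; exact: h.
  exists 1%N => // n /= n1; rewrite big_ltn//=.
  rewrite -[leLHS]addr0 lerD//; last by rewrite sumr_ge0// => k _; rewrite subr_ge0.
  by rewrite double0 mulrBl mul1r lerB// gap_step.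
apply: limr_le; first by apply/cvg_ex; eexists; exact: h.
(* Subtracting [gap t x n.*2] strengthens the bound so that the induction closes. *)
apply: nearW => n; apply: (@le_trans _ _ (gap t x 0%N - gap t x n.*2)).
  elim: n => [|n IH]; first by rewrite big_nil subrr.
  rewrite big_nat_recr//= doubleS; have := dec n.*2.+1; lra.
by rewrite gerBl gap_ge0.
Qed.

End AltTheta.

(** * Extrema of the normalized theta sum, and how its minimum changes under halving *)

Section Ratios.
Context {R : realType}.
Implicit Types s t u v x y : R.

(** If [f x > 1], iteration gives [f (2^n x) >= f x ^ (4^n)], which is unbounded by Bernoulli's
    inequality. This turns duplication formulas into sharp global bounds. *)
Lemma le1_of_pow4 (f : R -> R) (K : R) : (forall x, 0 <= f x) ->
  (forall x, f x <= K) -> (forall x, f x ^+ 4 <= f (2 * x)) -> forall x, f x <= 1.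
Proof.
move=> f0 fK f4 x; rewrite leNgt; apply/negP => fx.
have h n : f x ^+ (4 ^ n) <= f (2 ^+ n * x).
  elim: n => [|n IH]; first by rewrite expr1 mul1r.
  rewrite expnSr exprM [2 ^+ n.+1]exprS -mulrA; apply: le_trans (f4 _).
  by rewrite lerXn2r ?nnegrE ?exprn_ge0.
have bern n : 1 + n%:R * (f x - 1) <= f x ^+ n.
  elim: n => [|n IH]; first by rewrite mul0r addr0.
  have n0 : 0 <= n%:R * (f x - 1) ^+ 2 by rewrite mulr_ge0 ?sqr_ge0.
  have : f x * (1 + n%:R * (f x - 1)) <= f x * f x ^+ n by rewrite ler_wpM2l.
  rewrite exprS -(@natr1 _ n); lra.
have d0 : 0 < f x - 1 by rewrite subr_gt0.
have [n hn] : exists n : nat, K < n%:R * (f x - 1).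
  exists (Num.truncn (K / (f x - 1))).+1.
  by rewrite -ltr_pdivrMr// truncnS_gt.
have := fK (2 ^+ n * x); have := h n; have := bern (4 ^ n)%N.
have : n%:R * (f x - 1) <= (4 ^ n)%:R * (f x - 1).
  by rewrite ler_wpM2r ?(ltW d0)// ler_nat ltnW// ltn_expl.
lra.
Qed.

Definition theta_ratio t x : R := theta t x / theta t 0.

Definition theta_min t : R := theta_ratio t 2^-1.

Lemma theta_ratio_gt0 t x : 0 < t -> 0 < theta_ratio t x.
Proof. by move=> t0; rewrite divr_gt0 ?theta_gt0. Qed.

Lemma theta_sq2 t x : 0 < t -> theta t (2 * x) * theta t 0 =
  theta (2 * t) x ^+ 2 + theta (2 * t) (x + 2^-1) ^+ 2.
Proof.
move=> t0; have := theta_mulDB t x x t0.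
by rewrite subrr -!expr2 (_ : x + x = 2 * x); last by ring.
Qed.

Lemma theta_sq t x : 0 < t -> theta t x ^+ 2 =
  theta (2 * t) x * theta (2 * t) 0 + theta (2 * t) (x + 2^-1) * theta (2 * t) 2^-1.
Proof. by move=> t0; have := theta_mulDB t x 0 t0; rewrite addr0 subr0 add0r -expr2. Qed.

Lemma theta_half2 t x : 0 < t ->
  theta t (2 * x + 2^-1) * theta t 2^-1 = 2 * theta (2 * t) x * theta (2 * t) (x + 2^-1).
Proof.
move=> t0; have := theta_mulDB t (x + 2^-1) x t0.
rewrite (_ : x + 2^-1 + x = 2 * x + 2^-1); last by ring.
rewrite (_ : x + 2^-1 - x = 2^-1); last by ring.
rewrite (_ : x + 2^-1 + 2^-1 = x + 1); last by field.
by rewrite thetaD1 => ->; ring.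
Qed.

(** The condition of [le1_of_pow4] becomes, through the duplication formulas, the Cauchy-Schwarz
    inequality [(a p + b r)^2 <= (a^2 + b^2) (p^2 + r^2)]. *)
Lemma theta_ratio_le1 t x : 0 < t -> theta_ratio t x <= 1.
Proof.
move=> t0; have z0 := theta_gt0 t 0 t0.
apply: (@le1_of_pow4 (theta_ratio t) (2 / (1 - expR (- (t / 2))) / theta t 0)).
- by move=> y; rewrite ltW// theta_ratio_gt0.
- by move=> y; rewrite ler_pM2r ?invr_gt0// theta_le_bound.
move=> y; rewrite /theta_ratio expr_div_n ler_pdivrMr ?exprn_gt0//.
set z := theta t 0 in z0 *.
rewrite (_ : theta t (2 * y) / z * z ^+ 4 = theta t (2 * y) * z * z ^+ 2); last first.
  by field; exact: lt0r_neq0.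
rewrite theta_sq2//.
have -> : z ^+ 2 = theta (2 * t) 0 ^+ 2 + theta (2 * t) 2^-1 ^+ 2.
  by rewrite /z expr2; have := theta_sq2 t 0 t0; rewrite mulr0 add0r.
have -> : theta t y ^+ 4 = (theta t y ^+ 2) ^+ 2 by rewrite -exprM.
rewrite theta_sq//.
set a := theta _ y; set b := theta _ (y + _); set p := theta _ 0; set r := theta _ _.
have : 0 <= (a * r - b * p) ^+ 2 by exact: sqr_ge0.
lra.
Qed.

(** The same device, applied to [theta t (1/2) / theta t (y + 1/2)], reduces the claim to
    [4 (b p) (a r) <= (b p + a r)^2]. *)
Lemma theta_min_le t x : 0 < t -> theta_min t <= theta_ratio t x.
Proof.
move=> t0; have z0 := theta_gt0 t 0 t0; have h0 := theta_gt0 t 2^-1 t0.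
rewrite /theta_min /theta_ratio ler_pM2r ?invr_gt0//.
have th0 y := theta_gt0 t y t0.
pose f y := theta t 2^-1 / theta t (y + 2^-1).
have : f (x - 2^-1) <= 1.
  apply: (@le1_of_pow4 f (theta t 2^-1 / gauss t 1)).
  - by move=> y; rewrite divr_ge0 ?ltW.
  - move=> y; rewrite ler_pM2l// lef_pV2 ?posrE ?gauss_gt0//.
    exact: theta_ge_bound.
  move=> y; rewrite /f.
  have key : theta t 2^-1 ^+ 3 * theta t (2 * y + 2^-1) <= theta t (y + 2^-1) ^+ 4.
    have -> : theta t (y + 2^-1) ^+ 4 = (theta t (y + 2^-1) ^+ 2) ^+ 2 by rewrite -exprM.
    rewrite exprSr -mulrA [theta t 2^-1 * _]mulrC theta_half2// (theta_sq t (y + 2^-1))//.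
    have e : theta (2 * t) (2^-1 + 2^-1) = theta (2 * t) 0.
      by rewrite -[RHS]thetaD1; congr theta; field.
    rewrite (theta_sq t 2^-1)// e.
    rewrite (_ : y + 2^-1 + 2^-1 = y + 1) ?thetaD1; last by field.
    set a := theta _ y; set b := theta _ (y + _); set p := theta _ 0; set r := theta _ _.
    have : 0 <= (b * p - a * r) ^+ 2 by exact: sqr_ge0.
    lra.
  rewrite expr_div_n ler_pdivrMr ?exprn_gt0// -mulrA (mulrC (_^-1)) exprS ler_pM2l//.
  by rewrite ler_pdivlMr.
by rewrite /f subrK ler_pdivrMr// mul1r.
Qed.

Lemma theta_min_gt0 t : 0 < t -> 0 < theta_min t.
Proof. exact: theta_ratio_gt0. Qed.

Lemma theta_min_le1 t : 0 < t -> theta_min t <= 1.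
Proof. exact: theta_ratio_le1. Qed.

(** For the modulus [k = theta_min t ^+ 2] this is Landen's transformation. *)
Lemma theta_min_double t : 0 < t ->
  theta_min t ^+ 2 * (1 + theta_min (2 * t) ^+ 2) = 2 * theta_min (2 * t).
Proof.
move=> t0; have t20 : 0 < 2 * t by rewrite mulr_gt0.
rewrite /theta_min /theta_ratio.
have h1 := theta_half2 t 0 t0; have h2 := theta_sq2 t 0 t0.
rewrite mulr0 !add0r -?expr2 in h1 h2.
rewrite expr_div_n h1 h2; field.
rewrite lt0r_neq0 ?theta_gt0//=.
by rewrite lt0r_neq0// addr_gt0// exprn_gt0// theta_gt0.
Qed.

(** The doubling relation is equivalent to [(1 - m^2) (1 + M^2) = (1 - M)^2]. *)
Lemma theta_min_gap t : 0 < t -> 1 - theta_min t <= (1 - theta_min (2 * t)) ^+ 2.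
Proof.
move=> t0; have t20 : 0 < 2 * t by rewrite mulr_gt0.
have := theta_min_double t t0; have := theta_min_gt0 t t0; have := theta_min_le1 t t0.
have := theta_min_gt0 _ t20; have := theta_min_le1 _ t20.
set m := theta_min t; set M := theta_min (2 * t) => M1 M0 m1 m0 h.
have h1 : (1 - m ^+ 2) * (1 + M ^+ 2) = (1 - M) ^+ 2 by nra.
apply: (@le_trans _ _ (1 - m ^+ 2)); first by nra.
rewrite -h1 -[leLHS]mulr1 ler_wpM2l//; first by nra.
by rewrite lerDl sqr_ge0.
Qed.

End Ratios.

(** * d'Alembert's equation *)

Section DAlembert.
Context {R : realType}.
Implicit Types x y : R.

Lemma norm_antiperiodic (f : R -> R) : (forall x, f (x + 1) = - f x) ->
  forall x (m : int), `|f (x + m%:~R)| = `|f x|.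
Proof.
move=> f1.
have pos x (n : nat) : `|f (x + n%:R)| = `|f x|.
  by elim: n => [|n IH]; rewrite ?addr0// -natr1 addrA f1 normrN.
move=> x [n|n]; first exact: pos.
by rewrite NegzE intrN -[in RHS](subrK n.+1%:R x) pos.
Qed.

Lemma cos_sub_le x y : 0 <= x <= y -> y <= pi -> cos x - cos y <= y - x.
Proof.
move=> /andP[x0 xy] ypi.
have [c _ h] : exists2 c, c \in `[x, y] & cos y - cos x = - sin c * (y - x).
  apply: MVT_segment => //.
  by apply: continuous_subspaceT => c; exact: continuous_cos.
have := sin_le1 c; have := sin_geN1 c; nra.
Qed.

Variable C : R -> R.
Hypothesis C_eq : forall x y, C x * C y = (C (x + y) + C (x - y)) / 2.
Hypothesis C_0 : C 0 = 1.
Hypothesis C_half : C 2^-1 = 0.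
Hypothesis C_ge0 : forall x, - 2^-1 <= x <= 2^-1 -> 0 <= C x.

Let C_D1 x : C (x + 1) = - C x.
Proof.
have := C_eq (x + 2^-1) 2^-1; rewrite C_half mulr0 addrK.
rewrite (_ : x + 2^-1 + 2^-1 = x + 1); last by field.
lra.
Qed.

(** The chosen instance of [C_eq] amounts to [C x - C y = 2 C ((x + y - 1) / 2) C ((x - y + 1) /
    2)], and both arguments on the right lie in [[-1/2, 1/2]]. *)
Let C_nincr x y : 0 <= x <= y -> y <= 1 -> C y <= C x.
Proof.
move=> /andP[x0 xy] y1.
have := C_eq ((x + y + 1) / 2) ((x - y - 1) / 2).
rewrite (_ : (x + y + 1) / 2 + (x - y - 1) / 2 = x); last by field.
rewrite (_ : (x + y + 1) / 2 - (x - y - 1) / 2 = y + 1); last by field.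
rewrite (_ : (x + y + 1) / 2 = (x + y - 1) / 2 + 1); last by field.
have e := C_D1 ((x - y - 1) / 2).
rewrite (_ : (x - y - 1) / 2 + 1 = (x - y + 1) / 2) in e; last by field.
rewrite !C_D1 -[C ((x - y - 1) / 2)]opprK -e.
have h1 : 0 <= C ((x + y - 1) / 2) by apply: C_ge0; apply/andP; split; lra.
have h2 : 0 <= C ((x - y + 1) / 2) by apply: C_ge0; apply/andP; split; lra.
have := mulr_ge0 h1 h2; lra.
Qed.

(** The half-angle formula fixes the square of the value, and [C_ge0] fixes its sign. *)
Let C_dyadic k : C (2^-1 ^+ k.+1) = cos (pi * 2^-1 ^+ k.+1).
Proof.
elim: k => [|k IH]; first by rewrite expr1 C_half cos_pihalf.
have p0 : 0 < 2^-1 ^+ k.+2 :> R by rewrite exprn_gt0.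
have p1 : 2^-1 ^+ k.+2 <= 2^-1 :> R.
  by rewrite exprS ler_piMr// exprn_ile1// invf_le1// ler1n.
have e : 2^-1 ^+ k.+1 = 2^-1 ^+ k.+2 + 2^-1 ^+ k.+2 :> R.
  by rewrite [in RHS]exprS; field.
apply/eqP; rewrite -(@eqrXn2 _ 2)//; last 2 first.
- by apply: C_ge0; rewrite p1 andbT (le_trans _ (ltW p0))// oppr_le0.
- have h : (pi : R) * 2^-1 ^+ k.+2 <= pi / 2 by rewrite ler_wpM2l// pi_ge0.
  have h' : 0 <= (pi : R) * 2^-1 ^+ k.+2 by rewrite mulr_ge0 ?pi_ge0// ltW.
  by apply: cos_ge0_pihalf; rewrite h andbT (le_trans _ h')// oppr_le0 divr_ge0 ?pi_ge0.
have := C_eq (2^-1 ^+ k.+2) (2^-1 ^+ k.+2); rewrite subrr C_0 -e IH -expr2 => ->.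
rewrite e mulrDr -mulr2n cos_mulr2n; by apply/eqP; field.
Qed.

Let C_dyadic_mul k (m : nat) : C (m%:R * 2^-1 ^+ k.+1) = cos (pi * (m%:R * 2^-1 ^+ k.+1)).
Proof.
set h := 2^-1 ^+ k.+1.
(* The recurrence [C ((m + 2) h) = 2 C ((m + 1) h) C h - C (m h)] looks back two steps, so two
   consecutive values are carried. *)
suff : C (m%:R * h) = cos (pi * (m%:R * h)) /\
  C (m.+1%:R * h) = cos (pi * (m.+1%:R * h)) by case.
elim: m => [|m [IH1 IH2]]; first by rewrite !mul0r mulr0 cos0 C_0 !mul1r C_dyadic.
split=> //.
have := C_eq (m.+1%:R * h) h; rewrite IH2 C_dyadic.
rewrite (_ : m.+1%:R * h - h = m%:R * h); last by rewrite -natr1; ring.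
rewrite (_ : m.+1%:R * h + h = m.+2%:R * h); last by rewrite -[in RHS]natr1; ring.
rewrite IH1.
have e1 : pi * (m.+2%:R * h) = pi * (m.+1%:R * h) + pi * h by rewrite -[in LHS]natr1; ring.
have e2 : pi * (m%:R * h) = pi * (m.+1%:R * h) - pi * h by rewrite -[in RHS]natr1; ring.
rewrite e1 e2 cosB cosD; lra.
Qed.

(** On [[0, 1]] both functions are nonincreasing and agree at dyadic points, so they differ by at
    most the drop of the cosine between neighbouring dyadics. Antiperiodicity does the rest. *)
Lemma dalembert_cos x : C x = cos (pi * x).
Proof.
pose D x := C x - cos (pi * x).
have D1 y : D (y + 1) = - D y.
  by rewrite /D C_D1 mulrDr mulr1 cosDpi; ring.
suff h y : 0 <= y < 1 -> D y = 0.
  apply/eqP; rewrite -subr_eq0 -normr_eq0 -/(D x).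
  by rewrite -(norm_antiperiodic D D1 _ (- Num.floor x)) h ?normr0// subr_floor_itv.
move=> /andP[y0 y1]; apply/eqP; rewrite -normr_eq0.
have pi0 := pi_gt0 R.
have bound k : `|D y| <= pi * 2^-1 ^+ k.+1.
  set h := 2^-1 ^+ k.+1.
  have h0 : 0 < h by rewrite exprn_gt0.
  pose m := Num.truncn (y / h).
  have /andP[] : (m%:R <= y / h < m.+1%:R) by rewrite truncn_itv// divr_ge0// ltW.
  rewrite ler_pdivlMr// ltr_pdivrMr// => my ym.
  have m1 : m.+1%:R * h <= 1.
    rewrite /h exprVn -[leLHS]/(_ / _) ler_pdivrMr ?exprn_gt0// mul1r -natrX ler_nat.
    rewrite -(ltr_nat R) natrX; move: my; rewrite /h exprVn -[_ * _]/(_ / _).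
    rewrite ler_pdivrMr ?exprn_gt0// => /le_lt_trans; apply.
    by rewrite gtr_pMl// exprn_gt0.
  have m0 : 0 <= m%:R * h by rewrite mulr_ge0// ltW.
  have a1 := C_nincr (m%:R * h) y; have a2 := C_nincr y (m.+1%:R * h).
  rewrite !C_dyadic_mul in a1 a2.
  have {}a1 : C y <= cos (pi * (m%:R * h)) by apply: a1; lra.
  have {}a2 : cos (pi * (m.+1%:R * h)) <= C y by apply: a2; lra.
  have mono (u v : R) : 0 <= u <= v -> v <= 1 -> cos (pi * v) <= cos (pi * u).
    move=> /andP[u0 uv] v1; rewrite le_eqVlt; case: (eqVneq u v) => [->|uv']; first by rewrite eqxx.
    have pi01 (w : R) : 0 <= w <= 1 -> 0 <= pi * w <= pi.
      by move=> /andP[w0 w1]; rewrite mulr_ge0 ?(ltW pi0)//= ler_piMr ?(ltW pi0).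
    rewrite ltr_cos ?in_itv/= ?pi01//; last 2 first.
    - by apply/andP; split; lra.
    - by apply/andP; split; lra.
    by rewrite ltr_pM2l// lt_neqAle uv' uv orbT.
  have b1 : cos (pi * y) <= cos (pi * (m%:R * h)) by apply: mono; lra.
  have b2 : cos (pi * (m.+1%:R * h)) <= cos (pi * y) by apply: mono; lra.
  have : cos (pi * (m%:R * h)) - cos (pi * (m.+1%:R * h)) <= pi * h.
    apply: le_trans (cos_sub_le _ _ _ _) _.
    - by rewrite mulr_ge0 ?(ltW pi0)//= ler_pM2l// ler_pM2r// ler_nat.
    - by rewrite ler_piMr// ltW.
    by rewrite -mulrBr -mulrBl -(@natr1 _ m) addrAC subrr add0r mul1r.
  rewrite /D ler_norml; move=> ?; apply/andP; split; lra.
have : `|D y| <= 0; last by rewrite normr_le0 normr_eq0.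
have : (fun k => pi * 2^-1 ^+ k.+1) @ \oo --> (pi * 0 : R).
  apply: cvgMr; rewrite (cvg_shiftS (fun k => 2^-1 ^+ k : R)).
  by apply: cvg_expr; rewrite ger0_norm// invf_lt1// ltr1n.
rewrite mulr0 => hl; rewrite -(cvg_lim (@Rhausdorff R) hl).
by apply: limr_ge; [apply/cvg_ex; eexists; exact: hl|exact: nearW].
Qed.

End DAlembert.

(** * Convergence to the cosine *)

Section CosineLimit.
Context {R : realType}.
Implicit Types s t u v x y : R.

Lemma expRN_le t : 0 <= t -> expR (- t) <= (1 + t)^-1.
Proof.
move=> t0; rewrite expRN lef_pV2 ?posrE ?expR_gt0//; last by rewrite ltr_wpDr.
exact: expR_ge1Dx.
Qed.

(** [theta_alt_double] carries positivity from [2 * s] down to [s], so a large parameter suffices;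
    there the first gap dominates the alternating series. *)
Lemma theta_alt_gt0 t x : 0 < t -> - 2^-1 < x < 2^-1 -> 0 < theta_alt t x.
Proof.
move=> t0.
have down n : (forall x, - 2^-1 < x < 2^-1 -> 0 < theta_alt (2 ^+ n * t) x) ->
    forall x, - 2^-1 < x < 2^-1 -> 0 < theta_alt t x.
  elim: n => [|n IH] h; first by move=> y hy; have := h y hy; rewrite mul1r.
  apply: IH => y hy; have s0 : 0 < 2 ^+ n * t by rewrite mulr_gt0// exprn_gt0.
  have h0 : - 2^-1 < (0 : R) < 2^-1 by apply/andP; split; lra.
  have := mulr_gt0 (h y hy) (h 0 h0).
  by rewrite exprS -mulrA theta_alt_double// pmulr_rgt0// theta_gt0.
(* This makes [2^n t > 4], which is enough for [3 e^(-s/2) < 1] by [expRN_le]. *)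
pose n := (Num.truncn (4 / t)).+1.
apply: (down n) => y hy; set s := 2 ^+ n * t.
have s4 : 4 < s.
  have h : 4 < n%:R * t by rewrite -ltr_pdivrMr// truncnS_gt.
  rewrite (lt_le_trans h)// /s ler_wpM2r ?(ltW t0)// -natrX ler_nat ltnW//.
  by rewrite ltn_expl.
have s0 : 0 < s by lra.
have es : 3 * expR (- (s / 2)) < 1.
  have h : expR (- (s / 2)) <= (1 + s / 2)^-1 by apply: expRN_le; lra.
  rewrite mulrC -ltr_pdivlMr// mul1r (le_lt_trans h)// ltf_pV2 ?posrE//; lra.
have pos z : 0 <= z < 2^-1 -> 0 < theta_alt s z.
  move=> /andP[z0 z1].
  have hz : 0 <= z <= 2^-1 by rewrite z0 ltW.
  have /andP[+ _] := theta_alt_bounds s z s0 (ltW es) hz.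
  apply: lt_le_trans; rewrite mulr_gt0 ?subr_gt0//.
  rewrite ltr_expR ltrN2 ltr_pM2l ?divr_gt0//.
  by nra.
case/andP: hy => y0 y1; case: (lerP 0 y) => yy; first by apply: pos; rewrite yy.
by rewrite -theta_altN; apply: pos; apply/andP; split; lra.
Qed.

Lemma theta_alt0_gt0 t : 0 < t -> 0 < theta_alt t 0.
Proof. by move=> t0; apply: theta_alt_gt0 => //; apply/andP; split; lra. Qed.

Definition alt_ratio t x : R := theta_alt t x / theta_alt t 0.

Lemma alt_ratio0 t : 0 < t -> alt_ratio t 0 = 1.
Proof. by move=> t0; rewrite /alt_ratio divff// lt0r_neq0// theta_alt0_gt0. Qed.

Lemma alt_ratio_half t : alt_ratio t 2^-1 = 0.
Proof. by rewrite /alt_ratio theta_alt_half mul0r. Qed.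

Lemma alt_ratioD1 t x : alt_ratio t (x + 1) = - alt_ratio t x.
Proof. by rewrite /alt_ratio theta_altD1 mulNr. Qed.

Lemma alt_ratioN t x : alt_ratio t (- x) = alt_ratio t x.
Proof. by rewrite /alt_ratio theta_altN. Qed.

Lemma alt_ratio_gt0 t x : 0 < t -> - 2^-1 < x < 2^-1 -> 0 < alt_ratio t x.
Proof. by move=> t0 hx; apply: divr_gt0; [exact: theta_alt_gt0|exact: theta_alt0_gt0]. Qed.

Lemma alt_ratio_ge0 t x : 0 < t -> - 2^-1 <= x <= 2^-1 -> 0 <= alt_ratio t x.
Proof.
move=> t0 /andP[x0 x1].
have [->|xn] := eqVneq x (- 2^-1); first by rewrite alt_ratioN alt_ratio_half.
have [->|xp] := eqVneq x 2^-1; first by rewrite alt_ratio_half.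
by rewrite ltW// alt_ratio_gt0// !lt_neqAle x0 x1 xp eq_sym xn.
Qed.

Lemma alt_ratio_double s x : 0 < s ->
  alt_ratio (2 * s) x = theta_ratio s x * alt_ratio s x.
Proof.
move=> s0; have s20 : 0 < 2 * s by rewrite mulr_gt0.
have h := theta_alt_double s x s0; have h0 := theta_alt_double s 0 s0.
have n2 := lt0r_neq0 (theta_alt0_gt0 _ s20).
rewrite /alt_ratio /theta_ratio mulf_div -h -h0; field.
by rewrite n2.
Qed.

Lemma alt_ratio_dalembert s x y : 0 < s ->
  alt_ratio (2 * s) x * alt_ratio (2 * s) y =
  (theta_ratio s (x + y) * alt_ratio s (x - y) +
   alt_ratio s (x + y) * theta_ratio s (x - y)) / 2.
Proof.
move=> s0; have s20 : 0 < 2 * s by rewrite mulr_gt0.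
have h := theta_alt_dalembert s x y s0; have h1 := theta_alt_double s 0 s0.
rewrite /alt_ratio /theta_ratio mulf_div h h1.
have a0 := lt0r_neq0 (theta_alt0_gt0 _ s0); have h0 := lt0r_neq0 (theta_gt0 s 0 s0).
by field; rewrite a0 h0.
Qed.

(** * The limit under repeated halving of [t] *)

Section Halving.
Variables (t l : R).
Hypotheses (t_gt0 : 0 < t) (l_gt0 : 0 < l).
(** Since every ratio is at least [theta_min], this keeps the limit products away from zero,
    uniformly in [x]. *)
Hypothesis l_le : forall n, l <= \prod_(0 <= j < n) theta_min (t / 2 ^+ j.+1).

Let P x n := \prod_(0 <= j < n) theta_ratio (t / 2 ^+ j.+1) x.

Let tn_gt0 n : 0 < t / 2 ^+ n.
Proof. by rewrite divr_gt0// exprn_gt0. Qed.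

Let tnE n : t / 2 ^+ n = 2 * (t / 2 ^+ n.+1).
Proof. by rewrite exprS invfM mulrCA mulVKf. Qed.

Let P_ge x n : l <= P x n.
Proof.
apply: le_trans (l_le n) _; apply: ler_prod => j _.
by rewrite ltW ?theta_min_gt0//= theta_min_le.
Qed.

Let P_gt0 x n : 0 < P x n.
Proof. exact: lt_le_trans (P_ge _ _). Qed.

Let P_dec x : {homo P x : m n / (m <= n)%N >-> n <= m}.
Proof.
apply/nonincreasing_seqP => n; rewrite /P big_nat_recr//= ler_piMr ?(ltW (P_gt0 _ _))//.
exact: theta_ratio_le1.
Qed.

Let P_cvg x : P x @ \oo --> limn (P x).
Proof.
apply: (nonincreasing_is_cvgn (P_dec x)); exists l => _ [n _ <-]; exact: P_ge.
Qed.

Let L x := limn (P x).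

Let L_ge x : l <= L x.
Proof. by apply: limr_ge; [exact: P_cvg|apply: nearW => n; exact: P_ge]. Qed.

Let L_neq0 x : L x != 0.
Proof. exact/lt0r_neq0/(lt_le_trans l_gt0)/L_ge. Qed.

Let L_le1 x : L x <= 1.
Proof.
apply: limr_le; first exact: P_cvg.
by apply: nearW => n; have := P_dec x 0%N n (leq0n n); rewrite {2}/P big_nil.
Qed.

(** Each ratio is a quotient of consecutive partial products, which share a nonzero limit. *)
Let ratio_cvg x : (fun n => theta_ratio (t / 2 ^+ n.+1) x) @ \oo --> (1 : R).
Proof.
suff : (fun n => theta_ratio (t / 2 ^+ n.+1) x) @ \oo --> L x / L x.
  by rewrite divff.
rewrite (_ : (fun n => _) = (fun n => P x n.+1 / P x n)).
  by apply: cvgM; [rewrite (cvg_shiftS (P x)); exact: P_cvg|apply: cvgV => //; exact: P_cvg].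
apply/funext => n; have -> : P x n.+1 = P x n * theta_ratio (t / 2 ^+ n.+1) x.
  by rewrite /P big_nat_recr.
have n0 := lt0r_neq0 (P_gt0 x n).
by rewrite [RHS]mulrAC (divff n0) mul1r.
Qed.

Let altE x n : alt_ratio t x = alt_ratio (t / 2 ^+ n) x * P x n.
Proof.
elim: n => [|n IH]; first by rewrite divr1 /P big_nil mulr1.
by rewrite IH tnE alt_ratio_double// /P big_nat_recr//=; ring.
Qed.

Let C x := alt_ratio t x / L x.

Let C_cvg x : (fun n => alt_ratio (t / 2 ^+ n) x) @ \oo --> C x.
Proof.
rewrite (_ : (fun n => _) = (fun n => alt_ratio t x * (P x n)^-1)).
  by apply: cvgMr; apply: cvgV => //; exact: P_cvg.
apply/funext => n; have n0 := lt0r_neq0 (P_gt0 x n).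
by rewrite (altE x n) (mulfK n0).
Qed.

(** In [alt_ratio_dalembert] at [t / 2^(n+1)] the theta ratios tend to 1, so the approximate
    equation becomes exact in the limit. *)
Let C_eq x y : C x * C y = (C (x + y) + C (x - y)) / 2.
Proof.
have h1 : (fun n => alt_ratio (t / 2 ^+ n) x * alt_ratio (t / 2 ^+ n) y) @ \oo
    --> C x * C y by apply: cvgM; exact: C_cvg.
have C_cvgS z : (fun n => alt_ratio (t / 2 ^+ n.+1) z) @ \oo --> C z.
  by rewrite (cvg_shiftS (fun n => alt_ratio (t / 2 ^+ n) z)); exact: C_cvg.
have h2 : (fun n => (theta_ratio (t / 2 ^+ n.+1) (x + y) * alt_ratio (t / 2 ^+ n.+1) (x - y) +
   alt_ratio (t / 2 ^+ n.+1) (x + y) * theta_ratio (t / 2 ^+ n.+1) (x - y)) / 2) @ \oo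
  --> (1 * C (x - y) + C (x + y) * 1) / 2.
  by apply: cvgMl; apply: cvgD; apply: cvgM.
have e : (1 * C (x - y) + C (x + y) * 1) / 2 = (C (x + y) + C (x - y)) / 2 by ring.
rewrite e in h2.
have ef : (fun n => alt_ratio (t / 2 ^+ n) x * alt_ratio (t / 2 ^+ n) y) =
  (fun n => (theta_ratio (t / 2 ^+ n.+1) (x + y) * alt_ratio (t / 2 ^+ n.+1) (x - y) +
   alt_ratio (t / 2 ^+ n.+1) (x + y) * theta_ratio (t / 2 ^+ n.+1) (x - y)) / 2).
  by apply/funext => n; rewrite tnE; exact: alt_ratio_dalembert.
rewrite ef in h1; exact: (cvg_unique _ h1 h2).
Qed.

(** The factor [c] is the infinite product [L x] of theta ratios; dividing by it leaves a solution
    of d'Alembert's equation. *)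
Lemma alt_ratio_cos x : exists2 c, l <= c <= 1 & alt_ratio t x = c * cos (pi * x).
Proof.
exists (L x); first by rewrite L_ge L_le1.
rewrite -(@dalembert_cos R C) => [|//|||]; last 3 first.
- have h : L 0 = 1.
    apply: (cvg_lim (@Rhausdorff R)).
    rewrite (_ : P 0 = fun=> 1); first exact: cvg_cst.
    apply/funext => n; rewrite /P big1// => j _.
    by rewrite /theta_ratio divff// lt0r_neq0// theta_gt0.
  by rewrite /C h alt_ratio0// divr1.
- by rewrite /C alt_ratio_half mul0r.
- move=> y hy; rewrite divr_ge0 ?alt_ratio_ge0//.
  exact: le_trans (ltW l_gt0) (L_ge y).
by rewrite /C mulrC divfK.
Qed.

End Halving.

End CosineLimit.

(** * Size of the error *)

Section Estimates.
Context {R : realType}.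
Implicit Types s t x y : R.

(** From [x <= tan x] at [x = pi / 8] one gets [pi^2 <= 64 (3 - 2 sqrt 2) < 11]; numerically,
    [7071 / 10000] stands below [cos (pi / 4)]. *)
Lemma sqr_pi_le : (pi : R) ^+ 2 <= 11.
Proof.
have pi0 := pi_gt0 R.
pose x : R := pi / 8; have x0 : 0 < x by rewrite divr_gt0.
have [c + h] : exists2 c, c \in `[0, x] & sin x - sin 0 = cos c * (x - 0).
  apply: MVT_segment; first exact: ltW.
  by apply: continuous_subspaceT => c; exact: continuous_sin.
rewrite in_itv/= => /andP[c0 cx].
have hx : x = pi / 4 / 2 by rewrite /x; field.
have cosx0 : 0 < cos x.
  by apply: cos_gt0_pihalf; apply/andP; split; rewrite /x; lra.
have hc : cos x <= cos c.
  have [->//|cx'] := eqVneq c x.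
  rewrite ltW// ltr_cos ?in_itv/= ?lt_neqAle ?cx' ?cx//; apply/andP; split; rewrite /x in cx *; lra.
have h1 : x * cos x <= sin x.
  by move: h; rewrite sin0 !subr0 => ->; rewrite mulrC ler_wpM2r// ltW.
have h2 : (x * cos x) ^+ 2 <= sin x ^+ 2.
  by rewrite lerXn2r ?nnegrE// ?mulr_ge0 ?ltW//; apply: lt_le_trans h1; rewrite mulr_gt0.
have e1 : cos (pi / 4) = 2 * cos x ^+ 2 - 1 :> R.
  have := cos_mulr2n x; rewrite (_ : x *+ 2 = pi / 4); last by rewrite /x; field.
  by move=> ->; rewrite mulr_natl.
have e2 : 2 * cos (pi / 4) ^+ 2 = 1 :> R.
  have := @cos_mulr2n R (pi / 4); rewrite (_ : pi / 4 *+ 2 = pi / 2); last by field.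
  rewrite cos_pihalf; lra.
have q0 : 0 <= cos (pi / 4) :> R.
  by apply: cos_ge0_pihalf; apply/andP; split; lra.
have e3 := cos2Dsin2 x.
set q := cos (pi / 4) in e1 e2 q0; set a := cos x in e1 e3 h2 cosx0.
have q7 : 7071 / 10000 <= q by nra.
have : pi ^+ 2 = 64 * x ^+ 2 :> R by rewrite /x; field.
rewrite exprMn in h2.
nra.
Qed.

(** Since [(k + 1)^2 >= 2 k + 1], the terms off the origin are dominated by a geometric series of
    ratio [z^2]. *)
Lemma theta0_le t : 0 < t ->
  theta t 0 <= 1 + 2 * (expR (- (t / 2)) / (1 - expR (- (t / 2)) ^+ 2)).
Proof.
move=> t0; set z := expR _; have /andP[z0 z1] := expR_lt1_nng t t0; rewrite -/z in z0 z1.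
have g0 : gauss t 0 = 1 by rewrite /gauss expr0n/= mulr0 oppr0 expR0.
have gS k : gauss t k.+1%:R <= z * (z ^+ 2) ^+ k.
  rewrite -exprM -exprS /z -expRM_natl ler_expR mulrN lerN2 [leLHS]mulrC.
  rewrite ler_wpM2l ?divr_ge0 ?(ltW t0)// -natrX ler_nat; nia.
have sum_le n : \sum_(0 <= k < n) gauss t k.+1%:R <= z / (1 - z ^+ 2).
  apply: (@le_trans _ _ (\sum_(0 <= k < n) z * (z ^+ 2) ^+ k)); first exact: ler_sum.
  rewrite -mulr_sumr ler_wpM2l// geometric_sum_le// exprn_ge0//=.
  by rewrite exprn_ilt1.
apply: theta_le => // n.
rewrite (eq_bigr (fun k => gauss t k%:R + gauss t k.+1%:R)); last first.
  by move=> k _; rewrite addr0 subr0.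
rewrite big_split/=.
have : \sum_(0 <= k < n) gauss t k%:R <= 1 + \sum_(0 <= k < n) gauss t k.+1%:R.
  case: n => [|n]; first by rewrite !big_nil.
  rewrite big_nat_recl//= g0 lerD2l big_nat_recr//= lerDl; exact: gauss_ge0.
have := sum_le n; lra.
Qed.

Lemma gauss_half_le_theta t : 0 < t -> 2 * expR (- (t / 8)) <= theta t 2^-1.
Proof.
move=> t0; apply: le_trans (gauss2_le_theta _ _ t0).
rewrite (_ : 1 - 2^-1 = 2^-1); last by field.
rewrite (_ : gauss t 2^-1 = expR (- (t / 8))); last by rewrite /gauss; congr expR; field.
lra.
Qed.

(** Here [w], [z] and [E] are numerical stand-ins for [e^(-t/8)], [e^(-t/2)] and the target, with 11
    in place of [pi^2]. The last hypothesis is [(1 - E) (1 + 2 z / (1 - z^2)) <= 2 w] cleared of its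
    denominator. *)
Lemma theta_min_base t (w z E : R) : 0 < t -> 0 <= z < 1 ->
  w <= expR (- (t / 8)) -> expR (- (t / 2)) <= z -> E <= expR (- (11 / (2 * t))) -> E <= 1 ->
  (1 - E) * (1 - z ^+ 2 + 2 * z) <= 2 * w * (1 - z ^+ 2) ->
  1 - theta_min t <= expR (- (pi ^+ 2 / (2 * t))).
Proof.
move=> t0 /andP[z0 z1] hw hz hE E1 key.
apply: (@le_trans _ _ E); last first.
  apply: le_trans hE _; rewrite ler_expR lerN2 ler_wpM2r ?sqr_pi_le//.
  by rewrite invr_ge0 mulr_ge0// ltW.
have th : theta t 0 <= 1 + 2 * (z / (1 - z ^+ 2)).
  apply: le_trans (theta0_le _ t0) _; rewrite lerD2l ler_wpM2l//.
  have zz : z ^+ 2 < 1 by rewrite exprn_ilt1.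
  apply: ler_pM; rewrite ?expR_ge0//.
    by rewrite invr_ge0 subr_ge0 expr_le1 ?expR_ge0// (le_trans hz)// ltW.
  rewrite lef_pV2 ?posrE ?subr_gt0//; last first.
    by rewrite exprn_ilt1 ?expR_ge0// (le_lt_trans hz).
  by rewrite lerD2l lerN2 lerXn2r// nnegrE expR_ge0.
rewrite lerBlDl -lerBlDr /theta_min /theta_ratio ler_pdivlMr ?theta_gt0//.
apply: le_trans (gauss_half_le_theta _ t0).
apply: le_trans (_ : 2 * w <= _); last by rewrite ler_wpM2l.
apply: (@le_trans _ _ ((1 - E) * (1 + 2 * (z / (1 - z ^+ 2))))).
  by rewrite ler_wpM2l// subr_ge0.
have zz : 0 < 1 - z ^+ 2 by rewrite subr_gt0 exprn_ilt1.
rewrite (_ : 1 + 2 * _ = (1 - z ^+ 2 + 2 * z) / (1 - z ^+ 2)); last first.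
  by field; exact: lt0r_neq0.
by rewrite mulrA ler_pdivrMr.
Qed.

Lemma expR16_bounds (n : nat) :
  (15 / 16) ^+ n <= expR (- (n%:R / 16) : R) <= (16 / 17) ^+ n.
Proof.
rewrite -mulrN expRM_natl.
have h1 : 15 / 16 <= expR (- 16^-1) :> R by have := @expR_ge1Dx R (- 16^-1); lra.
have h2 : expR (- 16^-1) <= 16 / 17 :> R.
  have h : 0 <= 16^-1 :> R by [].
  by have := expRN_le _ h; rewrite (_ : (1 + 16^-1)^-1 = 16 / 17)//; field.
by rewrite !lerXn2r// ?nnegrE ?expR_ge0// divr_ge0.
Qed.

Lemma theta_min_48 t : 4 <= t <= 8 -> 1 - theta_min t <= expR (- (pi ^+ 2 / (2 * t))).
Proof.
have expR_ge y (n : nat) : y <= n%:R / 16 -> (15 / 16) ^+ n <= expR (- y).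
  move=> h; have /andP[+ _] := expR16_bounds n; move/le_trans; apply.
  by rewrite ler_expR lerN2.
have expR_le y (n : nat) : n%:R / 16 <= y -> expR (- y) <= (16 / 17) ^+ n.
  move=> h; have /andP[_] := expR16_bounds n; apply: le_trans.
  by rewrite ler_expR lerN2.
move=> /andP[t4 t8]; have t0 : 0 < t by lra.
have inv a b : 0 < a -> a <= t -> 11 / (2 * a) <= b -> 11 / (2 * t) <= b.
  move=> a0 at_ h; apply: le_trans h; rewrite ler_wpM2l// lef_pV2 ?posrE ?mulr_gt0//.
  by rewrite ler_pM2l.
(* On each of [[4, 5]], [[5, 6]] and [[6, 8]] the exponents count sixteenths: [t / 8] at the right
   end, [t / 2] and [11 / (2 t)] at the left end, the latter rounded up. *)
have [t5|t5] := leP t 5.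
  apply: (@theta_min_base t ((15 / 16) ^+ 10) ((16 / 17) ^+ 32) ((15 / 16) ^+ 22)) => //.
  - lra.
  - by apply: expR_ge; lra.
  - by apply: expR_le; lra.
  - by apply: expR_ge; apply: (inv 4) => //; lra.
  - lra.
  - lra.
have [t6|t6] := leP t 6.
  apply: (@theta_min_base t ((15 / 16) ^+ 12) ((16 / 17) ^+ 40) ((15 / 16) ^+ 18)) => //.
  - lra.
  - by apply: expR_ge; lra.
  - by apply: expR_le; lra.
  - by apply: expR_ge; apply: (inv 5) => //; lra.
  - lra.
  - lra.
apply: (@theta_min_base t ((15 / 16) ^+ 16) ((16 / 17) ^+ 48) ((15 / 16) ^+ 15)) => //.
- lra.
- by apply: expR_ge; lra.
- by apply: expR_le; lra.
- by apply: expR_ge; apply: (inv 6) => //; lra.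
- lra.
- lra.
Qed.

(** Halving [t] squares the exponential exactly and at least squares the gap, by [theta_min_gap], so
    the estimate descends from [[4, 8]]. *)
Lemma theta_min_le8 t : 0 < t <= 8 -> 1 - theta_min t <= expR (- (pi ^+ 2 / (2 * t))).
Proof.
have step n : forall s, 4 <= 2 ^+ n * s <= 8 ->
    1 - theta_min s <= expR (- (pi ^+ 2 / (2 * s))).
  elim: n => [|n IH] s hs; first by apply: theta_min_48; rewrite mul1r in hs.
  have s0 : 0 < s.
    have : 0 < 2 ^+ n.+1 * s by case/andP: hs => h _; lra.
    by rewrite pmulr_rgt0// exprn_gt0.
  apply: le_trans (theta_min_gap _ s0) _.
  have -> : expR (- (pi ^+ 2 / (2 * s))) = expR (- (pi ^+ 2 / (2 * (2 * s)))) ^+ 2.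
    rewrite -expRM_natl; congr expR; field; exact: lt0r_neq0.
  rewrite lerXn2r ?nnegrE ?expR_ge0//.
    by rewrite subr_ge0 theta_min_le1// mulr_gt0.
  by apply: IH; rewrite mulrA -exprSr.
move=> /andP[t0 t8].
have ex : exists n, 4 <= 2 ^+ n * t.
  pose n := (Num.truncn (4 / t)).+1; exists n.
  have h : 4 < n%:R * t by rewrite -ltr_pdivrMr// truncnS_gt.
  rewrite ltW// (lt_le_trans h)// ler_wpM2r ?(ltW t0)// -natrX ler_nat ltnW//.
  by rewrite ltn_expl.
(* Minimality of the exponent gives the upper bound 8: half of the scaled value is still below 4,
   unless the exponent is 0 and [t <= 8] applies. *)
have [[|n] h4 hmin] := ex_minnP ex.
  by apply: (step 0%N); rewrite h4 mul1r.
apply: (step n.+1); rewrite h4/=.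
have : 2 ^+ n * t < 4 by rewrite ltNge; apply/negP => /hmin; rewrite ltnn.
rewrite exprS; lra.
Qed.

Lemma prod1B_ge (a : nat -> R) n : (forall k, 0 <= a k <= 1) ->
  1 - \sum_(0 <= k < n) a k <= \prod_(0 <= k < n) (1 - a k).
Proof.
move=> ha; have p1 m : 0 <= \prod_(0 <= k < m) (1 - a k) <= 1.
  apply/andP; split; first by rewrite prodr_ge0// => k _; rewrite subr_ge0; case/andP: (ha k).
  by apply: prodr_ile1 => k; rewrite subr_ge0 gerBl; case/andP: (ha k) => -> ->.
elim: n => [|n IH]; first by rewrite !big_nil subr0.
rewrite !big_nat_recr//=; case/andP: (ha n) => a0 a1; case/andP: (p1 n) => P0 P1.
nra.
Qed.

(** The factor of index [k] is at least [1 - r^(2^k)], hence at least [1 - r^(k+1)]; the Weierstrass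
    inequality [prod1B_ge] and a geometric sum finish. *)
Lemma prod_theta_min_small t n : 0 < t <= 2 ->
  1 - expR (- (pi ^+ 2 / t)) / (1 - expR (- (pi ^+ 2 / t))) <=
  \prod_(0 <= j < n) theta_min (t / 2 ^+ j.+1).
Proof.
move=> /andP[t0 t2]; set r := expR _.
have pi2 : 0 < pi ^+ 2 :> R by rewrite exprn_gt0// pi_gt0.
have r1 : r < 1 by rewrite expR_lt1 oppr_lt0 divr_gt0.
have r0 : 0 < r by exact: expR_gt0.
have tj j : 0 < t / 2 ^+ j.+1 by rewrite divr_gt0// exprn_gt0.
pose a j := 1 - theta_min (t / 2 ^+ j.+1).
have -> : \prod_(0 <= j < n) theta_min (t / 2 ^+ j.+1) = \prod_(0 <= j < n) (1 - a j).
  by apply: eq_bigr => j _; rewrite /a subKr.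
apply: le_trans (prod1B_ge a n _); last first.
  by move=> k; rewrite subr_ge0 gerBl theta_min_le1//= ltW// theta_min_gt0.
rewrite lerD2l lerN2; apply: (@le_trans _ _ (\sum_(0 <= k < n) r * r ^+ k)); last first.
  by rewrite -mulr_sumr ler_wpM2l ?(ltW r0)// geometric_sum_le// (ltW r0).
apply: ler_sum => k _; rewrite -exprS.
have h8 : t / 2 ^+ k.+1 <= 8.
  rewrite ler_pdivrMr ?exprn_gt0//; have : 1 <= 2 ^+ k.+1 :> R by rewrite exprn_ege1// ler1n.
  lra.
apply: le_trans (theta_min_le8 _ _) _; first by rewrite tj h8.
rewrite /r -expRM_natl ler_expR mulrN lerN2.
rewrite (_ : pi ^+ 2 / (2 * (t / 2 ^+ k.+1)) = 2 ^+ k * (pi ^+ 2 / t)); last first.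
  have p0 : 2 ^+ k != 0 :> R by rewrite expf_neq0.
  by rewrite (exprS _ k); field; rewrite p0 lt0r_neq0.
rewrite ler_wpM2r ?divr_ge0 ?(ltW pi2) ?(ltW t0)// -natrX ler_nat.
by rewrite ltn_expl.
Qed.

Lemma small_ratio_bound t : 0 < t <= 2 -> expR (- (pi ^+ 2 / t)) <= 3^-1 :> R.
Proof.
move=> /andP[t0 t2]; have pi0 := pi_gt0 R.
have p2 : 4 <= pi ^+ 2 :> R by have := pi_ge2 R; nra.
have h : 2 <= pi ^+ 2 / t by rewrite ler_pdivlMr//; lra.
apply: le_trans (expRN_le _ _) _; first by lra.
by rewrite lef_pV2 ?posrE//; lra.
Qed.

(** For larger [t] the factor [theta_min (t / 2)] is split off and bounded crudely by [m]; what
    remains is the product for [t / 2]. *)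
Lemma prod_theta_min_lower k : exists2 l : R, 0 < l & forall t n,
  0 < t <= 2 ^+ k.+1 -> l <= \prod_(0 <= j < n) theta_min (t / 2 ^+ j.+1).
Proof.
elim: k => [|k [l l0 IH]].
  exists 2^-1 => // t n ht; apply: le_trans (prod_theta_min_small t n ht).
  have := small_ratio_bound _ ht; set r := expR _ => r3.
  have : r / (1 - r) <= 2^-1 by rewrite ler_pdivrMr; lra.
  lra.
(* With [s = t / 2], the numerator uses [s <= 2^(k+1)] in [theta_ge_bound], and the denominator uses
   [s >= 1] in [theta_le_bound]. *)
pose m : R := expR (- (2 ^+ k.+1 / 2)) / (2 / (1 - expR (- (1 / 2)))).
have e1 : expR (- (1 / 2)) < 1 :> R by rewrite expR_lt1 oppr_lt0.
have m0 : 0 < m by rewrite divr_gt0 ?expR_gt0// divr_gt0// subr_gt0.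
exists (Num.min (2^-1) (Num.min 1 (m * l))).
  by rewrite !lt_min invr_gt0 !ltr0n/= ltr01 mulr_gt0.
move=> t n /andP[t0 tk]; rewrite !ge_min.
have [t2|t2] := leP t 2.
  have ht : 0 < t <= 2 by rewrite t0.
  have := prod_theta_min_small t n ht.
  have := small_ratio_bound _ ht; set r := expR _ => r3.
  have : r / (1 - r) <= 2^-1 by rewrite ler_pdivrMr; lra.
  by move=> h1 h2; apply/orP; left; lra.
case: n => [|n]; first by rewrite big_nil lexx orbT.
apply/orP; right; apply/orP; right.
rewrite big_nat_recl//= expr1.
have s0 : 0 < t / 2 by rewrite divr_gt0.
have sk : t / 2 <= 2 ^+ k.+1 by rewrite ler_pdivrMr// -exprSr.
apply: ler_pM; rewrite ?(ltW m0) ?(ltW l0)//; last first.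
  rewrite (eq_bigr (fun j => theta_min (t / 2 / 2 ^+ j.+1))) ?IH ?s0//.
  by move=> j _; rewrite [in LHS]exprS invfM mulrA.
rewrite /m /theta_min /theta_ratio; apply: ler_pM; rewrite ?expR_ge0//.
- apply: le_trans (theta_ge_bound _ _ s0); rewrite /gauss ler_expR expr1n mulr1 lerN2.
  by rewrite ler_pM2r.
rewrite lef_pV2 ?posrE ?theta_gt0//.
apply: le_trans (theta_le_bound _ _ s0) _; rewrite ler_pM2l// lef_pV2 ?posrE ?subr_gt0//.
  by rewrite lerD2l lerN2 ler_expR lerN2 ler_pM2r// ler_pdivlMr//; lra.
by rewrite expR_lt1 oppr_lt0 divr_gt0.
Qed.

(** For [t <= 2] the constant 3 comes from [1 / (1 - 2 r) <= 3] with [r <= 1/3]. For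
    [2 < t <= 64 = 2^6] the exponential is at least [e^(-pi^2/2)], so [K] absorbs the fixed bound
    [l0]. *)
Lemma prod_theta_min_exp : exists2 K : R, 0 < K & forall t, 0 < t <= 64 ->
  exists l, [/\ 0 < l <= 1,
    forall n, l <= \prod_(0 <= j < n) theta_min (t / 2 ^+ j.+1) &
    l^-1 - 1 <= K * expR (- (pi ^+ 2 / t))].
Proof.
have [l0 l00 hl0] := prod_theta_min_lower 5.
have E0 : 0 < expR (- (pi ^+ 2 / 2)) :> R by exact: expR_gt0.
exists (3 + l0^-1 / expR (- (pi ^+ 2 / 2))).
  by rewrite addr_gt0// divr_gt0// invr_gt0.
move=> t /andP[t0 t64]; have [t2|t2] := leP t 2.
  have ht : 0 < t <= 2 by rewrite t0.
  have := small_ratio_bound _ ht; have := prod_theta_min_small t _ ht.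
  set r := expR _ => hr r3.
  have r0 : 0 < r by exact: expR_gt0.
  have r1 : r / (1 - r) <= 2^-1 by rewrite ler_pdivrMr; lra.
  have r2 : 0 < r / (1 - r) by rewrite divr_gt0//; lra.
  exists (1 - r / (1 - r)); split => //; first by apply/andP; split; lra.
  apply: (@le_trans _ _ (3 * r)).
    rewrite (_ : (1 - r / (1 - r))^-1 - 1 = r / (1 - 2 * r)); last first.
      field; apply/andP; split; apply: lt0r_neq0; lra.
    by rewrite ler_pdivrMr; nra.
  by rewrite ler_pM2r// lerDl divr_ge0 ?(ltW E0)// invr_ge0 ltW.
exists l0; split => //.
- by rewrite l00; have := hl0 t 0%N; rewrite big_nil; apply; rewrite t0 (le_trans t64)//; lra.
- by move=> n; apply: hl0; rewrite t0 (le_trans t64)//; lra.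
have hE : expR (- (pi ^+ 2 / 2)) <= expR (- (pi ^+ 2 / t)) :> R.
  rewrite ler_expR lerN2 ler_wpM2l ?sqr_ge0// lef_pV2 ?posrE//; exact: ltW.
have l0i : 0 < l0^-1 by rewrite invr_gt0.
apply: (@le_trans _ _ (l0^-1 / expR (- (pi ^+ 2 / 2)) * expR (- (pi ^+ 2 / t)))).
  apply: (@le_trans _ _ l0^-1); first by lra.
  by rewrite -mulrA ler_peMr ?(ltW l0i)// mulrC ler_pdivlMr// mul1r.
by rewrite ler_wpM2r ?expR_ge0// lerDr.
Qed.

End Estimates.

(** * Infinite products *)

Section QPochhammer.
Context {R : realType}.
Variable q : R.
Hypothesis q01 : 0 < q < 1.
Implicit Types a b : R.

Let q_gt0 : 0 < q. Proof. by case/andP: q01. Qed.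
Let q_lt1 : q < 1. Proof. by case/andP: q01. Qed.

Let partial a n := \prod_(0 <= k < n) (1 - a * q ^+ k).

Let partialS a n : partial a n.+1 = (1 - a) * partial (a * q) n.
Proof.
rewrite /partial big_nat_recl//= mulr1; congr (_ * _).
by apply: eq_bigr => k _; rewrite exprS mulrA.
Qed.

Let factor01 a k : 0 <= a <= 1 -> 0 <= a * q ^+ k <= 1.
Proof.
move=> /andP[a0 a1]; have h0 := exprn_ge0 k (ltW q_gt0).
have h1 : q ^+ k <= 1 by rewrite exprn_ile1// ltW.
by rewrite mulr_ge0//= mulr_ile1.
Qed.

Let partial01 a n : 0 <= a <= 1 -> 0 <= partial a n <= 1.
Proof.
move=> ha; rewrite /partial; apply/andP; split.
  by rewrite prodr_ge0// => k _; rewrite subr_ge0; case/andP: (factor01 a k ha).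
by apply: prodr_ile1 => k; case/andP: (factor01 a k ha) => *; rewrite subr_ge0 gerBl; apply/andP.
Qed.

Let is_cvg_partial a : 0 <= a -> cvgn (partial a).
Proof.
move=> a0.
have cvg01 b : 0 <= b <= 1 -> cvgn (partial b).
  move=> hb; apply: nonincreasing_is_cvgn.
    apply/nonincreasing_seqP => n; rewrite /partial big_nat_recr//= ler_piMr//.
      by case/andP: (partial01 b n hb).
    by rewrite gerBl; case/andP: (factor01 b n hb).
  by exists 0 => _ [n _ <-]; case/andP: (partial01 b n hb).
(* For an argument above 1 the leading factors may be negative; they are peeled off until the
   argument is at most 1 and monotonicity applies. *)
have down N b : 0 <= b -> b * q ^+ N <= 1 -> cvgn (partial b).
  elim: N b => [|N IH] b b0 hb; first by apply: cvg01; rewrite b0 -[b]mulr1.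
  have h : cvgn (partial (b * q)).
    by apply: IH; [rewrite mulr_ge0 ?(ltW q_gt0)|rewrite -mulrA -exprS].
  apply/cvg_ex; exists ((1 - b) * limn (partial (b * q))).
  rewrite -cvg_shiftS; rewrite (_ : (fun n => _) = (fun n => (1 - b) * partial (b * q) n)).
    exact: cvgMr.
  by apply/funext => n; rewrite partialS.
have [N hN] : exists N, a * q ^+ N <= 1.
  have hq : (fun n => a * q ^+ n) @ \oo --> a * 0.
    by apply: cvgMr; apply: cvg_expr; rewrite ger0_norm// ltW.
  rewrite mulr0 in hq; have /cvgr_le /(_ _ ltr01)[N _ hN] := hq.
  by exists N; apply: hN => /=.
exact: down hN.
Qed.

Lemma cvg_qpoch a : 0 <= a ->
  (fun n => \prod_(0 <= k < n) (1 - a * q ^+ k)) @ \oo --> qpoch a q.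
Proof. exact: is_cvg_partial. Qed.

Lemma qpoch_rec a : 0 <= a -> qpoch a q = (1 - a) * qpoch (a * q) q.
Proof.
move=> a0; have h1 := cvg_qpoch a a0.
have h2 : (fun n => (1 - a) * partial (a * q) n) @ \oo --> (1 - a) * qpoch (a * q) q.
  by apply: cvgMr; apply: cvg_qpoch; rewrite mulr_ge0 ?(ltW q_gt0).
have h3 : (fun n => partial a n.+1) @ \oo --> qpoch a q by rewrite (cvg_shiftS (partial a)).
have e : (fun n => partial a n.+1) = (fun n => (1 - a) * partial (a * q) n).
  by apply/funext => n; rewrite partialS.
by rewrite e in h3; exact: (cvg_unique _ h3 h2).
Qed.

Lemma qpoch1 : qpoch 1 q = 0.
Proof. by rewrite qpoch_rec// subrr mul0r. Qed.

Lemma qpoch_le1 a : 0 <= a <= 1 -> 0 <= qpoch a q <= 1.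
Proof.
move=> ha; have h : (fun n => partial a n) @ \oo --> qpoch a q.
  by apply: cvg_qpoch; case/andP: ha.
apply/andP; split.
  rewrite -(cvg_lim (@Rhausdorff R) h); apply: limr_ge.
    by apply/cvg_ex; eexists; exact: h.
  by apply: nearW => n; case/andP: (partial01 a n ha).
rewrite -(cvg_lim (@Rhausdorff R) h); apply: limr_le.
  by apply/cvg_ex; eexists; exact: h.
by apply: nearW => n; case/andP: (partial01 a n ha).
Qed.

(** All partial products lie in [[0, 1]], so the factor of index [n] increases the difference by at
    most [(b - a) q^n]. *)
Lemma qpoch_lipschitz a b : 0 <= a <= b -> b <= 1 ->
  0 <= qpoch a q - qpoch b q <= (b - a) / (1 - q).
Proof.
move=> /andP[a0 ab] b1; have b0 := le_trans a0 ab.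
have ha : 0 <= a <= 1 by rewrite a0 (le_trans ab).
have hb : 0 <= b <= 1 by rewrite b0.
have h : (fun n => partial a n - partial b n) @ \oo --> qpoch a q - qpoch b q.
  by apply: cvgB; apply: cvg_qpoch.
have hp n : 0 <= partial a n - partial b n <= (b - a) * \sum_(0 <= k < n) q ^+ k.
  elim: n => [|n /andP[IH0 IH1]].
    by rewrite /partial !big_nil mulr0 subrr lexx.
  rewrite /partial !big_nat_recr//= -/(partial a n) -/(partial b n).
  have /andP[Pa0 Pa1] := partial01 a n ha; have /andP[Pb0 Pb1] := partial01 b n hb.
  have /andP[f0 f1] := factor01 b n hb; have /andP[g0 g1] := factor01 a n ha.
  have fg : a * q ^+ n <= b * q ^+ n by rewrite ler_wpM2r// exprn_ge0// ltW.
  have fgE : b * q ^+ n - a * q ^+ n = (b - a) * q ^+ n by rewrite mulrBl.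
  rewrite [(b - a) * _]mulrDr -fgE.
  move: f0 f1 g0 g1 fg; set f := b * q ^+ n; set g := a * q ^+ n => f0 f1 g0 g1 fg.
  have e1 : 0 <= (partial a n - partial b n) * (1 - g) by rewrite mulr_ge0// subr_ge0.
  have e2 : 0 <= partial b n * (f - g) by rewrite mulr_ge0// subr_ge0.
  have e3 : partial b n * (f - g) <= f - g by rewrite ler_piMl// subr_ge0.
  have e4 : (partial a n - partial b n) * (1 - g) <= partial a n - partial b n.
    by rewrite ler_piMr// gerBl.
  by apply/andP; split; lra.
have q1 : 0 <= q < 1 by rewrite ltW.
apply/andP; split; rewrite -(cvg_lim (@Rhausdorff R) h).
  apply: limr_ge; first by apply/cvg_ex; eexists; exact: h.
  by apply: nearW => n; case/andP: (hp n).
apply: limr_le; first by apply/cvg_ex; eexists; exact: h.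
apply: nearW => n; case/andP: (hp n) => _ /le_trans; apply.
by rewrite ler_wpM2l ?subr_ge0// geometric_sum_le.
Qed.

Lemma qpoch0 : qpoch 0 q = 1.
Proof.
have h : (fun n => \prod_(0 <= k < n) (1 - 0 * q ^+ k)) @ \oo --> qpoch 0 q by exact: cvg_qpoch.
have e : (fun n => \prod_(0 <= k < n) (1 - 0 * q ^+ k)) = fun=> 1.
  by apply/funext => n; rewrite big1// => k _; rewrite mul0r subr0.
have h1 : (fun _ : nat => 1 : R) @ \oo --> (1 : R) by exact: cvg_cst.
by rewrite e in h; exact: (cvg_unique _ h h1).
Qed.

Lemma qpoch_ge a : 0 <= a <= 1 -> 1 - a / (1 - q) <= qpoch a q.
Proof.
move=> /andP[a0 a1]; have h0 : (0 : R) <= 0 <= a by rewrite lexx.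
by have := qpoch_lipschitz 0 a h0 a1; rewrite qpoch0 subr0 => /andP[_]; lra.
Qed.

(** [qpoch_ge] gives positivity once the argument is below [1 - q], and peeling finitely many
    positive factors brings it there. *)
Lemma qpoch_gt0 a : 0 <= a < 1 -> 0 < qpoch a q.
Proof.
have down N b : 0 <= b < 1 -> b * q ^+ N < 1 - q -> 0 < qpoch b q.
  elim: N b => [|N IH] b /andP[b0 b1] hb.
    rewrite mulr1 in hb; apply: lt_le_trans (qpoch_ge _ _); last by rewrite b0 ltW.
    by rewrite subr_gt0 ltr_pdivrMr ?subr_gt0// mul1r.
  rewrite qpoch_rec// mulr_gt0 ?subr_gt0//; apply: IH; last by rewrite -mulrA -exprS.
  by rewrite mulr_ge0 ?(ltW q_gt0)//= mulr_ilt1// ltW.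
move=> ha; have hq : (fun n => a * q ^+ n) @ \oo --> a * 0.
  by apply: cvgMr; apply: cvg_expr; rewrite ger0_norm// ltW.
have q1 : 0 < 1 - q by rewrite subr_gt0.
rewrite mulr0 in hq; have /cvgr_lt /(_ _ q1)[N _ hN] := hq.
by apply: (down N) => //; apply: hN => /=.
Qed.

End QPochhammer.

Lemma qpoch_double {R : realType} (q a : R) : 0 < q < 1 -> 0 <= a ->
  qpoch a q = qpoch a (q ^+ 2) * qpoch (a * q) (q ^+ 2).
Proof.
move=> hq a0; case/andP: (hq) => q0 q1.
have hq2 : 0 < q ^+ 2 < 1 by rewrite exprn_gt0//= exprn_ilt1// ltW.
have h1 : (fun n => (\prod_(0 <= k < n) (1 - a * (q ^+ 2) ^+ k)) *
    \prod_(0 <= k < n) (1 - a * q * (q ^+ 2) ^+ k)) @ \oo -->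
    qpoch a (q ^+ 2) * qpoch (a * q) (q ^+ 2).
  by apply: cvgM; apply: cvg_qpoch; rewrite ?mulr_ge0// ltW.
have h2 := cvg_qpoch q hq a a0.
have h3 : (fun n => \prod_(0 <= k < n.*2) (1 - a * q ^+ k)) @ \oo --> qpoch a q.
  apply: (cvg_comp (fun n => n.*2) _ _ h2).
  by apply/cvgnyPge => A; exists A => // n /= An; rewrite -addnn (leq_trans An)// leq_addr.
have e : (fun n => \prod_(0 <= k < n.*2) (1 - a * q ^+ k)) =
   (fun n => (\prod_(0 <= k < n) (1 - a * (q ^+ 2) ^+ k)) *
    \prod_(0 <= k < n) (1 - a * q * (q ^+ 2) ^+ k)).
  apply/funext; elim=> [|n IH]; first by rewrite !big_nil mulr1.
  by rewrite doubleS !big_nat_recr//= IH -exprM mul2n (exprS q n.*2); ring.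
by rewrite e in h3; exact: (cvg_unique _ h3 h1).
Qed.

(** * Jacobi's triple product *)

Section TripleProduct.
Context {R : realType}.
Implicit Types s t x y : R.

(** With [q = e^(-t)] and [y = x - 1/2], the two products are those of [q^x] and [q^(1-x)]; the
    Gaussian prefactor makes the whole even and antiperiodic, like [theta_alt]. *)
Definition theta_prod t y : R :=
  gauss t y * (qpoch (expR (- (t * (2^-1 + y)))) (expR (- t)) *
               qpoch (expR (- (t * (2^-1 - y)))) (expR (- t))).

Lemma expRN_01 t : 0 < t -> 0 < expR (- t) < 1.
Proof. by move=> t0; rewrite expR_gt0 expR_lt1 oppr_lt0. Qed.

Lemma theta_prodN t y : theta_prod t (- y) = theta_prod t y.
Proof. by rewrite /theta_prod gaussN opprK [X in _ * X]mulrC. Qed.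

Lemma theta_prod_half t : 0 < t -> theta_prod t 2^-1 = 0.
Proof.
by move=> t0; rewrite /theta_prod subrr mulr0 oppr0 expR0 qpoch1 ?mulr0// expRN_01.
Qed.

(** The shift removes [1 - u] from one product and adds [1 - v] to the other, with [u v = 1]. The
    Gaussian contributes [u], and [u (1 - v) = -(1 - u)]. *)
Lemma theta_prodD1 t y : 0 < t -> theta_prod t (y + 1) = - theta_prod t y.
Proof.
move=> t0; have q01 := expRN_01 _ t0; rewrite /theta_prod.
rewrite [qpoch (expR (- (t * (2^-1 + y)))) _]qpoch_rec ?expR_ge0//.
rewrite [qpoch (expR (- (t * (2^-1 - (y + 1))))) _]qpoch_rec ?expR_ge0// -!expRD.
have -> : - (t * (2^-1 + y)) - t = - (t * (2^-1 + (y + 1))) by ring.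
have -> : - (t * (2^-1 - (y + 1))) - t = - (t * (2^-1 - y)) by ring.
have -> : gauss t (y + 1) = gauss t y * expR (- (t * (2^-1 + y))).
  by rewrite /gauss -expRD; congr expR; field.
have e : expR (- (t * (2^-1 + y))) * expR (- (t * (2^-1 - (y + 1)))) = 1.
  by rewrite -expRD -[RHS]expR0; congr expR; field.
set u := expR (- (t * (2^-1 + y))) in e *; set v := expR (- (t * (2^-1 - (y + 1)))) in e *.
set X := qpoch _ _; set Y := qpoch _ _.
transitivity (gauss t y * X * Y * (u - u * v)); first by ring.
by rewrite e; ring.
Qed.

Lemma theta_prod_gt0 t y : 0 < t -> - 2^-1 < y < 2^-1 -> 0 < theta_prod t y.
Proof.
move=> t0 /andP[y0 y1]; have q01 := expRN_01 _ t0.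
rewrite /theta_prod !mulr_gt0 ?gauss_gt0// qpoch_gt0// expR_ge0 expR_lt1 oppr_lt0 mulr_gt0//; lra.
Qed.

Lemma theta_prod_quarter t y : 0 < t ->
  theta_prod (2 * t) (y / 2 + 4^-1) * theta_prod (2 * t) (y / 2 - 4^-1) =
  expR (- (t / 8)) * theta_prod t y.
Proof.
move=> t0; have q01 := expRN_01 _ t0; rewrite /theta_prod.
have e2 : expR (- (2 * t)) = expR (- t) ^+ 2 by rewrite -expRM_natl mulrN.
have d1 := qpoch_double _ _ q01 (expR_ge0 (- (t * (2^-1 + y)))).
have d2 := qpoch_double _ _ q01 (expR_ge0 (- (t * (2^-1 - y)))).
rewrite d1 d2 -!expRD e2.
have -> : 2 * t * (2^-1 + (y / 2 - 4^-1)) = t * (2^-1 + y) by field.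
have -> : 2 * t * (2^-1 - (y / 2 + 4^-1)) = t * (2^-1 - y) by field.
have -> : - (2 * t * (2^-1 + (y / 2 + 4^-1))) = - (t * (2^-1 + y)) - t by field.
have -> : - (2 * t * (2^-1 - (y / 2 - 4^-1))) = - (t * (2^-1 - y)) - t by field.
have e : gauss (2 * t) (y / 2 + 4^-1) * gauss (2 * t) (y / 2 - 4^-1) =
    expR (- (t / 8)) * gauss t y.
  by rewrite /gauss -!expRD; congr expR; field.
rewrite mulrACA e -!mulrA; congr (_ * (_ * _)).
set a := qpoch _ _; set b := qpoch _ _; set c := qpoch _ _; set d := qpoch _ _.
by ring.
Qed.

(** Splitting off [1 - w] produces the same envelope as in [theta_alt_bounds]; the two remaining
    infinite products multiply to a value between [1 - 3 e^(-t/2)] and 1. *)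
Lemma theta_prod_bounds t y : 0 < t -> 9 * expR (- (t / 2)) <= 1 -> 0 <= y <= 2^-1 ->
  (1 - 3 * expR (- (t / 2))) * (gauss t y - gauss t (1 - y)) <= theta_prod t y
    <= gauss t y - gauss t (1 - y).
Proof.
move=> t0; set z := expR (- (t / 2)) => z9 /andP[y0 y1].
have z0 : 0 < z by exact: expR_gt0.
have q01 := expRN_01 _ t0; have qE : expR (- t) = z ^+ 2.
  by rewrite /z -expRM_natl; congr expR; field.
set w := expR (- (t * (2^-1 - y))).
have w0 : 0 < w by exact: expR_gt0.
have w1 : w <= 1 by rewrite expR_le1 oppr_le0 mulr_ge0 ?(ltW t0)// subr_ge0.
have -> : gauss t y - gauss t (1 - y) = gauss t y * (1 - w).
  by rewrite mulrBr mulr1 /gauss -expRD; congr (_ - expR _); field.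
rewrite /theta_prod -/w [qpoch w _]qpoch_rec ?(ltW w0)// qE.
set p := expR (- (t * (2^-1 + y))).
have p0 : 0 < p by exact: expR_gt0.
have pz : p <= z by rewrite ler_expR lerN2; nra.
have wz : w * z ^+ 2 <= z / 9 by nra.
have q01' := q01; rewrite qE in q01'.
have p01 : 0 <= p <= 1 by apply/andP; split; lra.
have w01 : 0 <= w * z ^+ 2 <= 1 by rewrite mulr_ge0 ?sqr_ge0 ?(ltW w0)//=; lra.
have /andP[A0 A1] := qpoch_le1 _ q01' _ p01.
have /andP[B0 B1] := qpoch_le1 _ q01' _ w01.
have A2 := qpoch_ge _ q01' _ p01; have B2 := qpoch_ge _ q01' _ w01.
have zz : 1 - z ^+ 2 >= 80 / 81 by nra.
have zz0 : 0 < 1 - z ^+ 2 by lra.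
have A3 : p / (1 - z ^+ 2) <= 2 * z by rewrite ler_pdivrMr//; nra.
have B3 : w * z ^+ 2 / (1 - z ^+ 2) <= z by rewrite ler_pdivrMr//; nra.
set a := qpoch p _ in A0 A1 A2 *; set b := qpoch _ _ in B0 B1 B2 *.
have ab : 1 - 3 * z <= a * b by nra.
have ab1 : a * b <= 1 by rewrite mulr_ile1.
have g0 : 0 <= gauss t y * (1 - w) by rewrite mulr_ge0 ?gauss_ge0// subr_ge0.
rewrite (_ : gauss t y * (a * ((1 - w) * b)) = gauss t y * (1 - w) * (a * b)); last by ring.
by rewrite [X in X <= _]mulrC ler_wpM2l//= ler_piMr.
Qed.

Lemma bernoulli_sub (a : R) n : 0 <= a <= 1 -> 1 - n%:R * a <= (1 - a) ^+ n.
Proof.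
move=> /andP[a0 a1]; elim: n => [|n IH]; first by rewrite mul0r subr0.
have a1' : 0 <= 1 - a by rewrite subr_ge0.
have : (1 - a) * (1 - n%:R * a) <= (1 - a) * (1 - a) ^+ n by rewrite ler_wpM2l.
have : 0 <= n%:R * a ^+ 2 by rewrite mulr_ge0 ?sqr_ge0.
rewrite [(1 - a) ^+ n.+1]exprS -(@natr1 _ n); lra.
Qed.

Lemma expRN_sqr_le x : 0 <= x -> expR (- x) * x ^+ 2 <= 2.
Proof.
move=> x0; have h : 1 + x ^+ 2 / 2 <= expR x by exact: (@expR_ge1Dxn R x 1 x0).
have z0 := expR_gt0 (- x).
have : expR (- x) * (1 + x ^+ 2 / 2) <= expR (- x) * expR x by rewrite ler_pM2l.
rewrite [leRHS]mulrC expRxMexpNx_1 => h1; lra.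
Qed.

(** With [m = 2^n] and [z = e^(-m t/2)], Bernoulli's inequality reduces the claim to [6 m z < g],
    and [z (m t / 2)^2 <= 2] gives [6 m z <= 48 / (m t^2)]. The condition [16 < m t] yields
    [9 z <= 1]. *)
Lemma exists_pow_expR t (g : R) : 0 < t -> 0 < g -> exists n : nat,
  9 * expR (- (2 ^+ n * t / 2)) <= 1 /\
  1 - g < ((1 - 3 * expR (- (2 ^+ n * t / 2))) ^+ 2) ^+ (2 ^ n).
Proof.
move=> t0 g0; have tg0 : 0 < t ^+ 2 * g by rewrite mulr_gt0// exprn_gt0.
have [n [m [mE mt mtg]]] : exists (n : nat) (m : R),
    [/\ m = 2 ^+ n, 16 < m * t & 48 < m * (t ^+ 2 * g)].
  pose n := (Num.truncn (16 / t + 48 / (t ^+ 2 * g))).+1.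
  have hn : 16 / t + 48 / (t ^+ 2 * g) < 2 ^+ n.
    apply: (@lt_le_trans _ _ n%:R); first by rewrite truncnS_gt.
    by rewrite -natrX ler_nat ltnW// ltn_expl.
  exists n, (2 ^+ n); split=> //; rewrite -ltr_pdivrMr//; apply: le_lt_trans hn.
    by rewrite lerDl divr_ge0// ltW.
  by rewrite lerDr divr_ge0// ltW.
exists n; rewrite -mE; have m0 : 0 < m by rewrite mE exprn_gt0.
have mt0 : 0 <= m * t / 2 by rewrite !mulr_ge0 ?invr_ge0 ?(ltW m0) ?(ltW t0).
have h := expRN_le _ mt0; have h2 := expRN_sqr_le _ mt0.
have z0 := expR_gt0 (- (m * t / 2)).
set z := expR _ in h h2 z0 *.
have z9 : 9 * z <= 1.
  have : z * (1 + m * t / 2) <= 1 by rewrite -ler_pdivlMr ?mul1r//; lra.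
  nra.
split=> //.
have z6 : 0 <= 6 * z <= 1 by apply/andP; split; lra.
have h3 := bernoulli_sub (6 * z) (2 ^ n) z6; rewrite natrX -mE in h3.
apply: (@lt_le_trans _ _ ((1 - 6 * z) ^+ (2 ^ n))); last first.
  by rewrite lerXn2r ?nnegrE ?sqr_ge0//; nra.
apply: lt_le_trans h3; rewrite ltrD2l ltrN2.
have mt2 : 0 < m * t ^+ 2 by rewrite mulr_gt0// exprn_gt0.
rewrite -(ltr_pM2l mt2); nra.
Qed.

Let rho t y := theta_alt t y / theta_prod t y.

Let rho_gt0 t y : 0 < t -> - 2^-1 < y < 2^-1 -> 0 < rho t y.
Proof.
by move=> t0 hy; apply: divr_gt0; [exact: theta_alt_gt0|exact: theta_prod_gt0].
Qed.

(** Numerator and denominator share one envelope, so [rho] lies between [d] and [1 / d], and two of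
    its values compare up to [d^2]. *)
Let rho_bounds t y y' : 0 < t -> 9 * expR (- (t / 2)) <= 1 ->
  - 2^-1 < y < 2^-1 -> - 2^-1 < y' < 2^-1 ->
  (1 - 3 * expR (- (t / 2))) ^+ 2 * rho t y' <= rho t y.
Proof.
move=> t0 z9; set d := 1 - _.
have z0 : 0 < expR (- (t / 2)) by exact: expR_gt0.
have d0 : 0 < d by rewrite /d; lra.
have half u : 0 <= u < 2^-1 -> d <= rho t u /\ d * rho t u <= 1.
  move=> /andP[u0 u1]; have hu : 0 <= u <= 2^-1 by rewrite u0 ltW.
  have hu' : - 2^-1 < u < 2^-1 by apply/andP; split; lra.
  have z3 : 3 * expR (- (t / 2)) <= 1 by lra.
  have /andP[a1 a2] := theta_alt_bounds t u t0 z3 hu.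
  have /andP[b1 b2] := theta_prod_bounds t u t0 z9 hu.
  have P0 := theta_prod_gt0 _ _ t0 hu'.
  rewrite /rho mulrA ler_pdivlMr// ler_pdivrMr// mul1r; split.
    by apply: le_trans a1; rewrite ler_pM2l.
  by apply: le_trans b1; rewrite ler_pM2l.
have all u : - 2^-1 < u < 2^-1 -> d <= rho t u /\ d * rho t u <= 1.
  move=> /andP[u0 u1]; have [uu|uu] := leP 0 u; first by apply: half; rewrite uu.
  rewrite /rho -theta_altN -theta_prodN; apply: half; apply/andP; split; lra.
move=> hy hy'; have [h1 _] := all y hy; have [_ h2] := all y' hy'.
by rewrite expr2 -mulrA; apply: le_trans h1; rewrite ler_piMr// ltW.
Qed.

Let rho_quarter t : 0 < t -> exists2 k : R, 0 < k & forall y, - 2^-1 < y < 2^-1 ->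
  rho t y = k * (rho (2 * t) (y / 2 + 4^-1) * rho (2 * t) (y / 2 - 4^-1)).
Proof.
move=> t0; have t40 : 0 < 4 * t by rewrite mulr_gt0.
have T0 := theta_gt0 (4 * t) 4^-1 t40.
exists (expR (- (t / 8)) / theta (4 * t) 4^-1); first by rewrite divr_gt0 ?expR_gt0.
move=> y hy; rewrite /rho mulf_div.
have h1 := theta_alt_quarter t y t0; have h2 := theta_prod_quarter t y t0.
have P0 := lt0r_neq0 (theta_prod_gt0 _ _ t0 hy).
have E0 := lt0r_neq0 (expR_gt0 (- (t / 8))).
have T0' := lt0r_neq0 T0.
by rewrite h1 h2; field; rewrite E0 T0' P0.
Qed.

(** Each use of [rho_quarter] expresses [rho] by two values at the doubled parameter, so the
    comparison constant is squared. *)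
Let rho_down t n (d : R) : 0 < t -> 0 <= d ->
  (forall y y', - 2^-1 < y < 2^-1 -> - 2^-1 < y' < 2^-1 ->
    d * rho (2 ^+ n * t) y' <= rho (2 ^+ n * t) y) ->
  forall y y', - 2^-1 < y < 2^-1 -> - 2^-1 < y' < 2^-1 ->
    d ^+ (2 ^ n) * rho t y' <= rho t y.
Proof.
elim: n t => [|n IH] t t0 d0 h; first by rewrite mul1r in h; rewrite expr1.
have t20 : 0 < 2 * t by rewrite mulr_gt0.
have h' := IH (2 * t) t20 d0; rewrite mulrA -exprSr in h'.
have {h'}h := h' h.
move=> y y' hy hy'; have [k k0 hk] := rho_quarter t t0.
have quarter (u : R) : - 2^-1 < u < 2^-1 ->
    - 2^-1 < u / 2 + 4^-1 < 2^-1 /\ - 2^-1 < u / 2 - 4^-1 < 2^-1.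
  by move=> /andP[u0 u1]; split; apply/andP; split; lra.
have [a1 a2] := quarter _ hy; have [b1 b2] := quarter _ hy'.
rewrite !hk// mulrCA ler_pM2l// expnS mulnC exprM expr2 mulrACA.
by apply: ler_pM; rewrite ?h// mulr_ge0 ?exprn_ge0// ltW// rho_gt0.
Qed.

(** A relative shortfall [g > 0] contradicts [exists_pow_expR]. As [y] and [y'] are interchangeable,
    [rho t] is constant on the open interval. *)
Let rho_le t y y' : 0 < t -> - 2^-1 < y < 2^-1 -> - 2^-1 < y' < 2^-1 ->
  rho t y' <= rho t y.
Proof.
move=> t0 hy hy'; have r0 := rho_gt0 _ _ t0 hy'.
rewrite leNgt; apply/negP => hlt.
pose g := 1 - rho t y / rho t y'.
have g0 : 0 < g by rewrite subr_gt0 ltr_pdivrMr// mul1r.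
have [n [z9 hn]] := exists_pow_expR t g t0 g0.
have n0 : 0 < 2 ^+ n * t by rewrite mulr_gt0// exprn_gt0.
have key := rho_down t n _ t0 (sqr_ge0 _)
  (fun u u' hu hu' => rho_bounds _ _ _ n0 z9 hu hu') y y' hy hy'.
rewrite /g subKr in hn.
rewrite -ler_pdivlMr// in key.
by have := lt_le_trans hn key; rewrite ltxx.
Qed.

(* Jacobi's triple product, up to normalization: the ratio of both sides satisfies
   [rho t y = k * rho (2t) (y/2 + 1/4) * rho (2t) (y/2 - 1/4)] and tends to [1] faster than
   [expR (- t / 2)], so iterating [n] times leaves [2 ^ n] factors, which are
   [1 + O(expR (- 2 ^ n * t / 2))]. *)
Lemma alt_ratioE t y : 0 < t -> alt_ratio t y = theta_prod t y / theta_prod t 0.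
Proof.
move=> t0.
have h0 : - 2^-1 < (0 : R) < 2^-1 by apply/andP; split; lra.
have P0 := lt0r_neq0 (theta_prod_gt0 _ _ t0 h0).
have A0 := lt0r_neq0 (theta_alt0_gt0 _ t0).
have main u : - 2^-1 < u < 2^-1 -> alt_ratio t u = theta_prod t u / theta_prod t 0.
  move=> hu; have Pu := lt0r_neq0 (theta_prod_gt0 _ _ t0 hu).
  have : rho t u = rho t 0 by apply/eqP; rewrite eq_le !rho_le.
  rewrite /rho /alt_ratio => /eqP; rewrite eqr_div// => /eqP e.
  by apply/eqP; rewrite eqr_div// e mulrC.
pose D u := alt_ratio t u - theta_prod t u / theta_prod t 0.
have D1 u : D (u + 1) = - D u.
  by rewrite /D alt_ratioD1 theta_prodD1//; ring.
apply/eqP; rewrite -subr_eq0 -normr_eq0 -/(D y).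
rewrite -(norm_antiperiodic D D1 _ (- Num.floor (y + 2^-1))).
have /andP[] := subr_floor_itv (y + 2^-1).
set z := (- _)%:~R => z0 z1; have u0 : - 2^-1 <= y + z by lra.
have u1 : y + z < 2^-1 by lra.
move: u0 u1; set u := y + z => u0 u1.
have [->|un] := eqVneq u (- 2^-1).
  by rewrite /D alt_ratioN theta_prodN alt_ratio_half theta_prod_half// mul0r subrr normr0.
by rewrite /D main ?subrr ?normr0// u1 andbT lt_neqAle eq_sym un.
Qed.

End TripleProduct.

(** * The constant in the second formula *)

Section Slope.
Context {R : realType}.
Implicit Types t x y : R.

Lemma cvg_sin_pi_slope (u : nat -> R) : (forall n, 0 < u n <= 1) -> u @ \oo --> (0 : R) ->
  (fun n => sin (pi * u n) / u n) @ \oo --> (pi : R).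
Proof.
move=> u01 u0; have pi0 := pi_gt0 R.
have hc : (fun n => pi * cos (pi * u n)) @ \oo --> (pi : R).
  rewrite -[X in _ --> X]mulr1 -cos0 -(mulr0 pi); apply: cvgMr.
  apply: (@continuous_cvg _ _ _ _ _ _ (@cos R)); first exact: continuous_cos.
  exact: cvgMr.
have hp : (fun _ : nat => pi : R) @ \oo --> (pi : R) by exact: cvg_cst.
apply: (squeeze_cvgr _ hc hp); apply: nearW => n.
have /andP[n0 n1] := u01 n; have pn0 : 0 < pi * u n by rewrite mulr_gt0.
have pn1 : pi * u n <= pi by rewrite ler_piMr// ltW.
have [c + h] : exists2 c, c \in `[0, pi * u n] & sin (pi * u n) - sin 0 = cos c * (pi * u n - 0).
  apply: MVT_segment; first exact: ltW.
  by apply: continuous_subspaceT => c; exact: continuous_sin.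
rewrite in_itv/= => /andP[c0 cx].
have hcos : cos (pi * u n) <= cos c.
  have [->//|cx'] := eqVneq c (pi * u n).
  rewrite ltW// ltr_cos ?in_itv/= ?lt_neqAle ?cx' ?cx//; apply/andP; split; lra.
rewrite sin0 !subr0 in h; rewrite h ler_pdivlMr// ler_pdivrMr//.
have hc1 := cos_le1 c.
rewrite (_ : pi * cos (pi * u n) * u n = cos (pi * u n) * (pi * u n)); last by ring.
by rewrite ler_pM2r// hcos/= ler_piMl// ltW.
Qed.

Lemma cvg_expR_slope t (u : nat -> R) : 0 < t -> (forall n, 0 < u n <= 1) ->
  u @ \oo --> (0 : R) -> (fun n => (1 - expR (- (t * u n))) / u n) @ \oo --> t.
Proof.
move=> t0 u01 u0.
have hc : (fun n => t / (1 + t * u n)) @ \oo --> t.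
  have : (fun n => t / (1 + t * u n)) @ \oo --> t / (1 + t * 0).
    apply: cvgMr; apply: cvgV; first by rewrite mulr0 addr0 oner_neq0.
    by apply: cvgD; [exact: cvg_cst|exact: cvgMr].
  by rewrite mulr0 addr0 divr1.
have hp : (fun _ : nat => t) @ \oo --> t by exact: cvg_cst.
apply: (squeeze_cvgr _ hc hp); apply: nearW => n.
have /andP[n0 n1] := u01 n; have tn0 : 0 < t * u n by rewrite mulr_gt0.
have h1 := expRN_le _ (ltW tn0); have h2 := @expR_ge1Dx R (- (t * u n)).
rewrite ler_pdivlMr// ler_pdivrMr//; apply/andP; split; last by lra.
apply: le_trans (_ : 1 - (1 + t * u n)^-1 <= _); last by rewrite lerD2l lerN2.
rewrite le_eqVlt; apply/orP; left; apply/eqP; field.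
by apply: lt0r_neq0; lra.
Qed.

(** At the zero [-1/2] only the factor [1 - e^(-t u)] vanishes; [qpoch_rec] isolates it, and
    [qpoch_lipschitz] makes the other two products converge. *)
Lemma cvg_theta_prod_slope t : 0 < t ->
  (fun n => theta_prod t (harmonic n - 2^-1) / harmonic n) @ \oo -->
  expR (- (t / 8)) * (t * qpoch (expR (- t)) (expR (- t)) ^+ 2).
Proof.
move=> t0; have q01 := expRN_01 _ t0; set q := expR (- t) in q01 *.
pose u : nat -> R := harmonic.
have u0 : u @ \oo --> (0 : R) by exact: cvg_harmonic.
have u01 n : 0 < u n <= 1.
  by rewrite /u /harmonic invr_gt0 ltr0n/= invf_le1// ler1n.
have q1 : 0 < 1 - q by rewrite subr_gt0; case/andP: q01.
have hg : (fun n => gauss t (u n - 2^-1)) @ \oo --> expR (- (t / 8)).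
  have -> : expR (- (t / 8)) = gauss t (0 - 2^-1) by rewrite /gauss; congr expR; field.
  apply: (@continuous_cvg _ _ _ _ _ _ (@expR R)); first exact: continuous_expR.
  apply: cvgN; apply: cvgMr; have h : (fun n => u n - 2^-1) @ \oo --> (0 - 2^-1 : R).
    by apply: cvgB => //; exact: cvg_cst.
  by rewrite expr2; under eq_fun do rewrite expr2; exact: cvgM.
have hexp (s : R) : (fun n => expR (- (t * (1 + s * u n)))) @ \oo --> q.
  have -> : q = expR (- (t * (1 + s * 0))) by rewrite mulr0 addr0 mulr1.
  apply: (@continuous_cvg _ _ _ _ _ _ (@expR R)); first exact: continuous_expR.
  apply: cvgN; apply: cvgMr; apply: cvgD; [exact: cvg_cst|exact: cvgMr].
have ha : (fun n => qpoch (expR (- (t * (1 + 1 * u n)))) q) @ \oo --> qpoch q q.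
  have h : (fun n => qpoch q q + (q - expR (- (t * (1 + 1 * u n)))) / (1 - q)) @ \oo --> qpoch q q.
    rewrite -[X in _ --> X]addr0; apply: cvgD; first exact: cvg_cst.
    rewrite -(mul0r (1 - q)^-1); apply: cvgMl; rewrite -(subrr q).
    by apply: cvgB; [exact: cvg_cst|exact: hexp].
  apply: (squeeze_cvgr _ (cvg_cst _) h); apply: nearW => n; case/andP: (u01 n) => un0 un1.
  have le1 : expR (- (t * (1 + 1 * u n))) <= q.
    by rewrite ler_expR lerN2 ler_peMr ?(ltW t0)//; lra.
  have le2 : q <= 1 by lra.
  have := qpoch_lipschitz q q01 (expR (- (t * (1 + 1 * u n)))) q.
  rewrite expR_ge0 le1 => /(_ isT le2) /andP[e1 e2]; apply/andP; split; lra.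
have hb : (fun n => qpoch (expR (- (t * (1 + -1 * u n)))) q) @ \oo --> qpoch q q.
  have h : (fun n => qpoch q q - (expR (- (t * (1 + -1 * u n))) - q) / (1 - q)) @ \oo --> qpoch q q.
    rewrite -[X in _ --> X]subr0; apply: cvgB; first exact: cvg_cst.
    rewrite -(mul0r (1 - q)^-1); apply: cvgMl; rewrite -(subrr q).
    by apply: cvgB; [exact: hexp|exact: cvg_cst].
  apply: (squeeze_cvgr _ h (cvg_cst _)); apply: nearW => n; case/andP: (u01 n) => un0 un1.
  have le1 : q <= expR (- (t * (1 + -1 * u n))).
    by rewrite ler_expR lerN2 ler_piMr ?(ltW t0)//; lra.
  have le2 : expR (- (t * (1 + -1 * u n))) <= 1.
    by rewrite expR_le1 oppr_le0 mulr_ge0 ?(ltW t0)//; lra.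
  have := qpoch_lipschitz q q01 q (expR (- (t * (1 + -1 * u n)))).
  rewrite expR_ge0 le1 => /(_ isT le2) /andP[e1 e2]; apply/andP; split; lra.
have e : (fun n => theta_prod t (harmonic n - 2^-1) / harmonic n) =
  (fun n => gauss t (u n - 2^-1) * ((1 - expR (- (t * u n))) / u n *
    (qpoch (expR (- (t * (1 + 1 * u n)))) q * qpoch (expR (- (t * (1 + -1 * u n)))) q))).
  apply/funext => n; rewrite -/(u n) /theta_prod -/q.
  rewrite (_ : 2^-1 + (u n - 2^-1) = u n); last by field.
  rewrite (_ : 2^-1 - (u n - 2^-1) = 1 + -1 * u n); last by field.
  rewrite (qpoch_rec q q01 (expR (- (t * u n)))) ?expR_ge0//.
  rewrite (_ : expR (- (t * u n)) * q = expR (- (t * (1 + 1 * u n)))); last first.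
    by rewrite /q -expRD; congr expR; ring.
  set a := qpoch _ _; set b := qpoch _ _; ring.
rewrite e expr2; apply: cvgM => //; apply: cvgM; last exact: cvgM.
exact: cvg_expR_slope.
Qed.

(** Dividing [c cos] by the distance to its zero [-1/2] traps the slope of the product side. Hence
    slope over [pi] can replace [theta_prod t 0] as the normalization, which gives the second
    formula. *)
Lemma theta_prod_slope_bounds t l : 0 < t ->
  (forall x, exists2 c, l <= c <= 1 & alt_ratio t x = c * cos (pi * x)) ->
  l * (theta_prod t 0 * pi) <= expR (- (t / 8)) * (t * qpoch (expR (- t)) (expR (- t)) ^+ 2)
    <= theta_prod t 0 * pi.
Proof.
move=> t0 hl; have hV := cvg_theta_prod_slope t t0.
have h0 : - 2^-1 < (0 : R) < 2^-1 by apply/andP; split; lra.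
have P0 := theta_prod_gt0 t 0 t0 h0.
pose u : nat -> R := harmonic.
have u0 : u @ \oo --> (0 : R) by exact: cvg_harmonic.
have u01 n : 0 < u n <= 1.
  by rewrite /u /harmonic invr_gt0 ltr0n/= invf_le1// ler1n.
have hS := cvg_sin_pi_slope u u01 u0.
have hb n : l * (theta_prod t 0 * (sin (pi * u n) / u n)) <=
    theta_prod t (harmonic n - 2^-1) / harmonic n <=
    theta_prod t 0 * (sin (pi * u n) / u n).
  rewrite -/(u n); have /andP[n0 n1] := u01 n.
  have [c /andP[c0 c1]] := hl (u n - 2^-1); rewrite alt_ratioE// => /eqP.
  rewrite mulrBr cosBpihalf => hc.
  have {hc} -> : theta_prod t (u n - 2^-1) = c * (theta_prod t 0 * sin (pi * u n)).
    by move: hc; rewrite -(inj_eq (mulIf (lt0r_neq0 P0))) divfK ?lt0r_neq0// => /eqP ->; ring.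
  have s0 : 0 <= theta_prod t 0 * (sin (pi * u n) / u n).
    rewrite mulr_ge0 ?(ltW P0)// divr_ge0 ?(ltW n0)// sin_ge0_pi//.
    by rewrite mulr_ge0 ?pi_ge0 ?(ltW n0)//= ler_piMr ?pi_ge0.
  rewrite (_ : c * _ / u n = c * (theta_prod t 0 * (sin (pi * u n) / u n))); last by ring.
  apply/andP; split; first by rewrite ler_wpM2r.
  by rewrite ler_piMl.
have hSP : (fun n => theta_prod t 0 * (sin (pi * u n) / u n)) @ \oo --> theta_prod t 0 * pi.
  exact: cvgMr.
have hSl : (fun n => l * (theta_prod t 0 * (sin (pi * u n) / u n))) @ \oo --> l * (theta_prod t 0 * pi).
  exact: cvgMr.
apply/andP; split.
  by apply: (ler_cvg_to hSl hV); apply: nearW => n; case/andP: (hb n).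
by apply: (ler_cvg_to hV hSP); apply: nearW => n; case/andP: (hb n).
Qed.

End Slope.

(** * The uniform error bound and its translation to q-gamma functions *)

Section Main.
Context {R : realType}.
Implicit Types q t x y : R.

(** Both approximations are [d sin (pi x)] with [l <= d <= 1/l], so the error is at most [1/l - 1].
    In the first [d = c]; in the second [d = c P pi / V], where [V] is the slope. *)
Lemma theta_prod_approx : exists C : R, forall t x, 0 < t <= 64 ->
  `|sin (pi * x) - theta_prod t (x - 2^-1) / theta_prod t 0| <= C * expR (- (pi ^+ 2 / t)) /\
  `|sin (pi * x) - theta_prod t (x - 2^-1) *
     (pi / (expR (- (t / 8)) * (t * qpoch (expR (- t)) (expR (- t)) ^+ 2)))|
     <= C * expR (- (pi ^+ 2 / t)).
Proof.
have [C C0 hC] := @prod_theta_min_exp R; exists C => t x ht; have /andP[t0 _] := ht.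
have [l [/andP[l0 l1] hl lC]] := hC t ht.
have hcos := alt_ratio_cos t l t0 l0 hl.
have /andP[V1 V2] := theta_prod_slope_bounds t l t0 hcos.
have h0 : - 2^-1 < (0 : R) < 2^-1 by apply/andP; split; lra.
have P0 := theta_prod_gt0 t 0 t0 h0.
set V := expR (- (t / 8)) * _ in V1 V2 *.
have V0 : 0 < V by apply: lt_le_trans V1; exact: mulr_gt0 l0 (mulr_gt0 P0 (pi_gt0 R)).
have [c /andP[c0 c1]] := hcos (x - 2^-1); rewrite alt_ratioE// mulrBr cosBpihalf => hc.
have tE : theta_prod t (x - 2^-1) = c * sin (pi * x) * theta_prod t 0.
  by rewrite -hc divfK// lt0r_neq0.
set P := theta_prod t 0 in P0 hc tE V1 V2 *.
have near1 d : l <= d -> d <= l^-1 ->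
    `|sin (pi * x) - d * sin (pi * x)| <= C * expR (- (pi ^+ 2 / t)).
  move=> d1 d2; apply: le_trans lC.
  rewrite -[X in `|X - _|]mul1r -mulrBl normrM.
  have s1 : `|sin (pi * x)| <= 1 by rewrite ler_norml sin_geN1 sin_le1.
  apply: (@le_trans _ _ `|1 - d|); first by rewrite ler_piMr.
  have ll : l * l^-1 = 1 by rewrite divff// lt0r_neq0.
  have li : 0 < l^-1 by rewrite invr_gt0.
  rewrite ler_norml; apply/andP; split; nra.
have l1i : 1 <= l^-1 by rewrite invf_ge1.
split; first by rewrite hc near1//; lra.
rewrite tE (_ : c * sin (pi * x) * P * (pi / V) = c * (P * pi / V) * sin (pi * x)); last by ring.
have k1 : 1 <= P * pi / V by rewrite ler_pdivlMr// mul1r.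
have k2 : P * pi / V <= l^-1.
  by rewrite ler_pdivrMr// ler_pdivlMl.
have ci : 0 <= c by lra.
apply: near1.
  by rewrite -[l]mulr1; apply: ler_pM => //; lra.
by rewrite -[leRHS]mul1r; apply: ler_pM => //; lra.
Qed.

Lemma infprod_qpoch q a b d : 0 < q < 1 -> 0 <= a -> 0 <= b -> 0 <= d < 1 ->
  infprod (fun k => (1 - a * q ^+ k) * (1 - b * q ^+ k) / (1 - d * q ^+ k) ^+ 2) =
  qpoch a q * qpoch b q / qpoch d q ^+ 2.
Proof.
move=> q01 a0 b0 /andP[d0 d1]; apply: (cvg_lim (@Rhausdorff R)).
have -> : (fun n => \prod_(0 <= k < n)
    ((1 - a * q ^+ k) * (1 - b * q ^+ k) / (1 - d * q ^+ k) ^+ 2)) =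
  (fun n => (\prod_(0 <= k < n) (1 - a * q ^+ k)) * (\prod_(0 <= k < n) (1 - b * q ^+ k)) /
    ((\prod_(0 <= k < n) (1 - d * q ^+ k)) * (\prod_(0 <= k < n) (1 - d * q ^+ k)))).
  by apply/funext => n; rewrite !big_split/= prodfV prodrXl expr2.
apply: cvgM; first by apply: cvgM; exact: cvg_qpoch.
apply: cvgV; first by rewrite mulf_neq0// lt0r_neq0// qpoch_gt0// d0.
by apply: cvgM; exact: cvg_qpoch.
Qed.

Lemma infprod_theta t x s : 0 < t -> 0 < s ->
  infprod (fun k : nat =>
    (1 - expR (- t) `^ (k%:R + x)) * (1 - expR (- t) `^ (k%:R + 1 - x))
      / (1 - expR (- t) `^ (k%:R + s)) ^+ 2) =
  qpoch (expR (- (t * x))) (expR (- t)) * qpoch (expR (- (t * (1 - x)))) (expR (- t)) /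
    qpoch (expR (- (t * s))) (expR (- t)) ^+ 2.
Proof.
move=> t0 s0; have q01 := expRN_01 _ t0.
rewrite -infprod_qpoch ?expR_ge0//=; last by rewrite expR_lt1 oppr_lt0 mulr_gt0.
congr infprod; apply/funext => k.
have e y : expR (- t) `^ (k%:R + y) = expR (- (t * y)) * expR (- t) ^+ k.
  by rewrite -expRM -expRM_natl -expRD; congr expR; ring.
by rewrite -addrA !e.
Qed.

(** By [0^-1 = 0] this covers the poles too: there the product in [x] vanishes and both sides are
    0. *)
Lemma Gamma_q_inv q x : (Gamma_q q x)^-1 = qpoch (q `^ x) q / (qpoch q q * (1 - q) `^ (1 - x)).
Proof. by rewrite /Gamma_q !invfM invrK -mulrA mulrCA. Qed.

Lemma Gamma_q_reflection q x : 0 < q < 1 ->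
  (Gamma_q q x)^-1 * (Gamma_q q (1 - x))^-1 =
  qpoch (q `^ x) q * qpoch (q `^ (1 - x)) q / (qpoch q q ^+ 2 * (1 - q)).
Proof.
move=> /andP[q0 q1]; rewrite !Gamma_q_inv mulf_div; congr (_ / _).
rewrite mulrACA expr2 -powRD; last by rewrite implybE orbC gt_eqF// subr_gt0.
by rewrite (_ : 1 - x + (1 - (1 - x)) = 1) ?powRr1 ?subr_ge0 ?(ltW q1)//; ring.
Qed.

Lemma Gamma_q_half_sqr q : 0 < q < 1 ->
  Gamma_q q 2^-1 ^+ 2 = qpoch q q ^+ 2 * (1 - q) / qpoch (q `^ 2^-1) q ^+ 2.
Proof.
move=> /andP[q0 q1]; rewrite /Gamma_q exprMn expr_div_n.
rewrite [_ `^ _ ^+ 2]expr2 -powRD; last by rewrite implybE orbC gt_eqF// subr_gt0.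
rewrite (_ : 1 - 2^-1 + (1 - 2^-1) = 1); last by field.
by rewrite powRr1 ?subr_ge0 ?(ltW q1)// mulrAC.
Qed.

Lemma theta_prodE t x : theta_prod t (x - 2^-1) = expR (- t) `^ (2^-1 * (x - 2^-1) ^+ 2) *
  (qpoch (expR (- (t * x))) (expR (- t)) * qpoch (expR (- (t * (1 - x)))) (expR (- t))).
Proof.
rewrite /theta_prod /gauss -expRM.
rewrite (_ : 2^-1 + (x - 2^-1) = x); last by field.
rewrite (_ : 2^-1 - (x - 2^-1) = 1 - x); last by field.
by congr (expR _ * _); field.
Qed.

Lemma theta_prod0 t : theta_prod t 0 = qpoch (expR (- (t * 2^-1))) (expR (- t)) ^+ 2.
Proof. by rewrite /theta_prod /gauss expr0n/= mulr0 oppr0 expR0 mul1r addr0 expr2. Qed.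

(** The prefactor [e^(-t/8)] comes from [(x - 1/2)^2 / 2 = x (x - 1) / 2 + 1/8]. *)
Lemma theta_prodE' t x : theta_prod t (x - 2^-1) =
  expR (- (t / 8)) * expR (- t) `^ (x * (x - 1) / 2) *
  (qpoch (expR (- (t * x))) (expR (- t)) * qpoch (expR (- (t * (1 - x)))) (expR (- t))).
Proof.
by rewrite theta_prodE -!expRM -expRD; congr (expR _ * _); field.
Qed.

(** The bound 64 is generous: [e^(-64) <= 2^(-64)] is already below [4 / 10^13]. *)
Lemma exp_param q : 4 * 10 ^- 13 < q < 1 ->
  exists t, [/\ 0 < t <= 64, q = expR (- t) & ln q = - t].
Proof.
move=> /andP[q0 q1]; have q0' : 0 < q by apply: le_lt_trans q0; rewrite mulr_ge0.
exists (- ln q); rewrite opprK lnK ?posrE//; split=> //.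
rewrite oppr_gt0 ln_lt0 ?q0'//= leNgt; apply/negP => h.
have : q <= expR (- 64) by rewrite -[q]lnK ?posrE// ler_expR; lra.
have e : expR (- 64) <= (2^-1) ^+ 64 :> R.
  have -> : - 64 = 64%:R * -1 :> R by ring.
  rewrite expRM_natl lerXn2r ?nnegrE ?expR_ge0//.
  by have := @expRN_le R 1 ler01.
have : (2^-1) ^+ 64 < 4 * 10 ^- 13 :> R.
  rewrite ltr_pdivlMr ?exprn_gt0//; lra.
lra.
Qed.

End Main.

Theorem theorem7p3 (R : realType) :
  (eq_upto_O (fun x q : R => sin (pi * x))
     (fun x q : R =>
        q `^ (2^-1 * (x - 2^-1) ^+ 2) *
        (Gamma_q q 2^-1 ^+ 2 * ((Gamma_q q x)^-1 * (Gamma_q q (1 - x))^-1)))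
   /\
   eq_upto_O (fun x q : R => sin (pi * x))
     (fun x q : R =>
        q `^ (2^-1 * (x - 2^-1) ^+ 2) *
        infprod (fun k : nat =>
          (1 - q `^ (k%:R + x)) * (1 - q `^ (k%:R + 1 - x))
          / (1 - q `^ (k%:R + 2^-1)) ^+ 2)))
  /\
  (eq_upto_O (fun x q : R => sin (pi * x))
     (fun x q : R =>
        pi * q `^ (x * (x - 1) / 2) *
        ((1 - q) / ln q^-1 * ((Gamma_q q x)^-1 * (Gamma_q q (1 - x))^-1)))
   /\
   eq_upto_O (fun x q : R => sin (pi * x))
     (fun x q : R =>
        pi * q `^ (x * (x - 1) / 2) * (ln q^-1)^-1 *
        infprod (fun k : nat =>
          (1 - q `^ (k%:R + x)) * (1 - q `^ (k%:R + 1 - x))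
          / (1 - q `^ (k%:R + 1)) ^+ 2))).
Proof.
have [C hC] := @theta_prod_approx R.
(* Since [ln q = - t], the error term is [e^(-pi^2/t)], and each of the four formulas reduces to an
   exact identity in [t]. *)
have approx1 (f : R -> R -> R) :
    (forall t x, 0 < t -> f x (expR (- t)) = theta_prod t (x - 2^-1) / theta_prod t 0) ->
    eq_upto_O (fun x q : R => sin (pi * x)) f.
  move=> hf; exists C => x q /exp_param[t [ht -> lnE]]; have /andP[t0 _] := ht.
  by rewrite expRK invrN mulrN hf//; case: (hC t x ht).
have approx2 (f : R -> R -> R) :
    (forall t x, 0 < t -> f x (expR (- t)) = theta_prod t (x - 2^-1) *
      (pi / (expR (- (t / 8)) * (t * qpoch (expR (- t)) (expR (- t)) ^+ 2)))) ->
    eq_upto_O (fun x q : R => sin (pi * x)) f.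
  move=> hf; exists C => x q /exp_param[t [ht -> lnE]]; have /andP[t0 _] := ht.
  by rewrite expRK invrN mulrN hf//; case: (hC t x ht).
have qx t x : expR (- t) `^ x = expR (- (t * x)) :> R by rewrite -expRM mulNr.
have Q0 t : 0 < t -> qpoch (expR (- t)) (expR (- t)) != 0 :> R.
  move=> t0; have q01 := expRN_01 _ t0.
  by rewrite gt_eqF// qpoch_gt0//; case/andP: q01 => /ltW -> ->.
split; split.
- apply: approx1 => t x t0; have q01 := expRN_01 _ t0.
  rewrite Gamma_q_reflection// Gamma_q_half_sqr// theta_prodE theta_prod0 !qx.
  have hQ := Q0 t t0; have hq : 1 - expR (- t) != 0 by rewrite gt_eqF// subr_gt0 expR_lt1 oppr_lt0.
  have hH : qpoch (expR (- (t * 2^-1))) (expR (- t)) != 0.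
    by rewrite gt_eqF// qpoch_gt0// expR_ge0 expR_lt1 oppr_lt0 mulr_gt0.
  set A := qpoch _ _ in hH *; set Q := qpoch _ _ in hQ *; set B := qpoch _ _; set D := qpoch _ _.
  by field; rewrite hQ hq hH.
- apply: approx1 => t x t0; rewrite infprod_theta ?invr_gt0// theta_prodE theta_prod0.
  by rewrite mulrA.
- apply: approx2 => t x t0; have q01 := expRN_01 _ t0.
  rewrite Gamma_q_reflection// theta_prodE' !qx -expRN opprK expRK.
  have hQ := Q0 t t0; have hq : 1 - expR (- t) != 0 by rewrite gt_eqF// subr_gt0 expR_lt1 oppr_lt0.
  have he := lt0r_neq0 (expR_gt0 (- (t / 8))).
  set Q := qpoch (expR (- t)) _ in hQ *; set A := qpoch _ _; set B := qpoch _ _.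
  by field; rewrite hQ hq he gt_eqF.
apply: approx2 => t x t0; rewrite infprod_theta// theta_prodE' mulr1 -expRN opprK expRK.
have hQ := Q0 t t0; have he := lt0r_neq0 (expR_gt0 (- (t / 8))).
set Q := qpoch (expR (- t)) _ in hQ *; set A := qpoch _ _; set B := qpoch _ _.
by field; rewrite hQ he gt_eqF.
Qed.
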